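(* Let $k$ be an algebraically closed field of characteristic $0$, and let $D=A_1(k)$ be the first Weyl algebra over $k$. Then the category $\mathbf{grHol}(D)$ of graded holonomic $D$-modules is uniserial. Moreover, any graded holonomic $D$-module is a finite direct sum of the indecomposable ones, given by \[ \{ M(\alpha,n): \alpha\in I,\; n\ge 1 \}, \] where $M(\alpha,n)=D/D\,w(\alpha,n)$ for $\alpha=0,1$ and $M(\alpha,n)=D/D(E-\alpha)^n$ for $\alpha\in I\setminus\{0,1\}$.
   Context: $D=A_1(k)=k[t]\langle\partial\rangle$ with relation $\partial t=t\partial+1$, and $E=t\partial$. $D$ is $\mathbb{Z}$-graded, with $t^i\partial^j$ homogeneous of weight $i-j$. The category $\mathbf{gr}\mathbf{Mod}(D)$ has as objects the $\mathbb{Z}$-graded left $D$-modules and as morphisms the homogeneous homomorphisms of any degree; in particular, graded modules differing by a shift of grading are isomorphic. $\mathbf{grHol}(D)$ is the full subcategory of $\mathbf{gr}\mathbf{Mod}(D)$ consisting of the objects of finite length; its objects are called graded holonomic $D$-modules. The category $\mathbf{grHol}(D)$ is uniserial if every indecomposable object $M$ in it is uniserial, i.e. the lattice of (graded) submodules of $M$ is a chain. The direct sum decomposition is into graded submodules, each isomorphic in $\mathbf{gr}\mathbf{Mod}(D)$ to some $M(\alpha,n)$. $I=I'\cup\{1\}$, where $I'\subseteq k$ is a fixed subset containing $0$ such that the composition $I'\to k\to k/\mathbb{Z}$ is a bijection. For $\alpha\in\{0,1\}$, $w(\alpha,n)$ is the alternating word of length $n$ in the letters $t,\partial$, ending (on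 the right) in $\partial$ if $\alpha=0$ and ending in $t$ if $\alpha=1$. The modules $M(\alpha,n)$ carry the grading induced from $D$. *)

(* Defs.v *)
From HB Require Import structures.
From mathcomp Require Import all_boot all_order all_algebra generic_quotient ring_quotient.
From mathcomp Require Import boolp classical_sets functions.

Set Implicit Arguments.
Unset Strict Implicit.
Unset Printing Implicit Defensive.

Import GRing.Theory.
Local Open Scope ring_scope.
Local Open Scope quotient_scope.

(* An element of A_1(k) is stored in normal form: the polynomial of           *)
(* polynomials P stands for \sum_(i, j) (P`_j)`_i t^i ∂^j, with ∂ the outer   *)
(* variable (lemma weylE).                                                    *)

Section WeylMul.
Variable k : fieldType.
Implicit Types P Q S : {poly {poly k}}.

(* Left multiplication by ∂, from ∂ a = a ∂ + a' for a in k[t]. *)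
Definition wder Q : {poly {poly k}} := 'X * Q + map_poly (@deriv k) Q.

Definition wmul P Q : {poly {poly k}} :=
  \sum_(i < size P) P`_i *: iter i wder Q.

Lemma coef_wder Q j :
  (wder Q)`_j = (if j is j'.+1 then Q`_j' else 0) + (Q`_j)^`().
Proof.
rewrite /wder coefD coefXM coef_map_id0 ?raddf0 //.
by case: j.
Qed.

Lemma wder_zmod_morphism : zmod_morphism wder.
Proof.
move=> P Q; apply/polyP=> j; rewrite [RHS]coefB !coef_wder !coefB derivB.
by case: j => [|j]; rewrite ?subr0 ?add0r ?coefB // opprD addrACA.
Qed.

HB.instance Definition _ :=
  GRing.isZmodMorphism.Build {poly {poly k}} {poly {poly k}} wder
    wder_zmod_morphism.

Lemma wderZ (a : {poly k}) Q : wder (a *: Q) = a *: wder Q + a^`() *: Q.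
Proof.
apply/polyP=> j; rewrite [RHS]coefD coef_wder !coefZ coef_wder derivM mulrDr.
by case: j => [|j]; rewrite ?coefZ ?mulr0 -!addrA; congr (_ + _); rewrite addrC.
Qed.

Lemma wderC (c : k) Q : wder (c%:P *: Q) = c%:P *: wder Q.
Proof. by rewrite wderZ derivC scale0r addr0. Qed.

Lemma wder_iter_zmod_morphism n : zmod_morphism (iter n wder).
Proof. by move=> P Q; elim: n => //= n ->; rewrite raddfB. Qed.

HB.instance Definition _ n :=
  GRing.isZmodMorphism.Build {poly {poly k}} {poly {poly k}} (iter n wder)
    (wder_iter_zmod_morphism n).

Lemma wmul_widen n P Q : (size P <= n)%N ->
  wmul P Q = \sum_(i < n) P`_i *: iter i wder Q.
Proof.
move=> le_n; rewrite /wmul (big_ord_widen n (fun i => P`_i *: iter i wder Q)) //.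
rewrite big_mkcond; apply: eq_bigr => i _; case: ltnP => // le_i.
by rewrite nth_default // scale0r.
Qed.

Lemma wmulDl : left_distributive wmul +%R.
Proof.
move=> P Q S; pose n := maxn (size P) (size Q).
rewrite !(@wmul_widen n) ?leq_maxl ?leq_maxr ?(leq_trans (size_polyD _ _)) //.
by rewrite -big_split; apply: eq_bigr => i _; rewrite coefD scalerDl.
Qed.

Lemma wmulDr : right_distributive wmul +%R.
Proof.
move=> P Q S; rewrite /wmul -big_split; apply: eq_bigr => i _ /=.
by rewrite raddfD scalerDr.
Qed.

Lemma wmul0 P : wmul P 0 = 0.
Proof. by rewrite /wmul big1 // => i _; rewrite raddf0 scaler0. Qed.

Lemma w0mul P : wmul 0 P = 0.
Proof. by rewrite /wmul size_poly0 big_ord0. Qed.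

Lemma wmulZl (a : {poly k}) P Q : wmul (a *: P) Q = a *: wmul P Q.
Proof.
rewrite (@wmul_widen (size P)) ?size_scale_leq // scaler_sumr.
by apply: eq_bigr => i _; rewrite coefZ scalerA.
Qed.

Lemma wmul_suml n (F : 'I_n -> {poly {poly k}}) Q :
  wmul (\sum_i F i) Q = \sum_i wmul (F i) Q.
Proof.
by apply: (big_morph (wmul^~ Q)) => [P S|]; rewrite ?w0mul ?wmulDl.
Qed.

Lemma wmulXn n Q : wmul 'X^n Q = iter n wder Q.
Proof.
rewrite /wmul size_polyXn (bigD1 ord_max) //= coefXn eqxx scale1r.
rewrite big1 ?addr0 // => i ne_i; rewrite coefXn.
by rewrite -val_eqE /= in ne_i; rewrite (negPf ne_i) scale0r.
Qed.

Lemma wder_wmul Q S : wder (wmul Q S) = wmul (wder Q) S.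
Proof.
rewrite -[Q in RHS]coefK poly_def !raddf_sum wmul_suml.
apply: eq_bigr => i _ /=; rewrite !wderZ wmulDl !wmulZl wmulXn; congr (_ *: _ + _).
have ->: wder 'X^i = 'X^(i.+1).
  apply/polyP=> j; rewrite coef_wder !coefXn -polyC_natr derivC addr0.
  by case: j => [|j]; rewrite ?coefXn.
by rewrite wmulXn.
Qed.

Lemma wmulA : associative wmul.
Proof.
move=> P Q S; rewrite {2}/wmul wmul_suml /wmul; apply: eq_bigr => i _.
rewrite -!/(wmul _ _) wmulZl; congr (_ *: _).
by elim: (i : nat) => //= n ->; rewrite wder_wmul.
Qed.

Lemma w1mul : left_id 1 wmul.
Proof. by move=> P; rewrite /wmul size_poly1 big_ord1 coefC scale1r. Qed.

Lemma wder_iter1 n : iter n wder 1 = 'X^n.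
Proof. by rewrite -wmulXn; elim: n => [|n IH];
  rewrite ?expr0 ?w1mul // wmulXn /= -wmulXn IH;
  apply/polyP=> j; rewrite coef_wder !coefXn -polyC_natr derivC addr0;
  case: j => [|j]; rewrite ?coefXn. Qed.

Lemma wmul1 : right_id 1 wmul.
Proof.
move=> P; rewrite -[RHS]coefK poly_def; apply: eq_bigr => i _.
by rewrite wder_iter1.
Qed.

End WeylMul.

Definition weyl (k : fieldType) : Type := {poly {poly k}}.

Section WeylAlgebra.
Variable k : fieldType.
Local Notation D := (weyl k).

HB.instance Definition _ := GRing.Zmodule.copy D {poly {poly k}}.

Lemma weyl_oner_neq0 : (1 : {poly {poly k}}) != 0 :> D.
Proof. exact: oner_neq0. Qed.

HB.instance Definition _ := GRing.Zmodule_isNzRing.Build D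
  (@wmulA k) (@w1mul k) (@wmul1 k) (@wmulDl k) (@wmulDr k) weyl_oner_neq0.

Definition weyl_scale (c : k) (P : D) : D := c%:P *: (P : {poly {poly k}}).

Lemma weyl_scaleA a b v : weyl_scale a (weyl_scale b v) = weyl_scale (a * b) v.
Proof. by rewrite /weyl_scale scalerA polyCM. Qed.
Lemma weyl_scale1 : left_id 1 weyl_scale.
Proof. by move=> v; rewrite /weyl_scale scale1r. Qed.
Lemma weyl_scaleDr : right_distributive weyl_scale +%R.
Proof. by move=> c u v; rewrite /weyl_scale; exact: scalerDr. Qed.
Lemma weyl_scaleDl v : {morph weyl_scale^~ v : a b / a + b}.
Proof. by move=> a b; rewrite /weyl_scale polyCD scalerDl. Qed.

HB.instance Definition _ := GRing.Zmodule_isLmodule.Build k D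
  weyl_scaleA weyl_scale1 weyl_scaleDr weyl_scaleDl.

Lemma weyl_scaleAl (c : k) (P Q : D) : c *: (P * Q) = c *: P * Q.
Proof. exact/esym/wmulZl. Qed.

HB.instance Definition _ := GRing.Lmodule_isLalgebra.Build k D weyl_scaleAl.

Lemma weyl_scaleAr (c : k) (P Q : D) : c *: (P * Q) = P * (c *: Q).
Proof.
rewrite /GRing.scale /= /weyl_scale /GRing.mul /= /wmul scaler_sumr.
apply: eq_bigr => i _.
have -> : iter i (@wder k) (c%:P *: Q) = c%:P *: iter i (@wder k) Q.
  by elim: (i : nat) => //= n ->; rewrite wderC.
by rewrite !scalerA mulrC.
Qed.

HB.instance Definition _ := GRing.Lalgebra_isAlgebra.Build k D weyl_scaleAr.

Definition wt : D := ('X)%:P : {poly {poly k}}.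
Definition wd : D := 'X : {poly {poly k}}.
Definition wE : D := wt * wd.

Definition wcoef (P : D) (i j : nat) : k := (P : {poly {poly k}})`_j`_i.

Lemma weylP (P Q : D) : wcoef P =2 wcoef Q -> P = Q.
Proof. by move=> eqPQ; apply/polyP=> j; apply/polyP=> i; exact: eqPQ. Qed.

Lemma wdM (P : D) : wd * P = wder P.
Proof. by rewrite /wd /GRing.mul /= -['X]expr1 wmulXn. Qed.

Lemma wdt : wd * wt = wt * wd + 1.
Proof.
rewrite wdM; have -> : wt * wd = ('X)%:P * 'X :> {poly {poly k}}.
  rewrite {1}/GRing.mul /= /wmul size_polyC polyX_eq0 big_ord1 /= coefC eqxx.
  by rewrite mul_polyC.
by rewrite /wder mulrC map_polyC /= derivX.
Qed.

Lemma wtMd i j : wt ^+ i * wd ^+ j = ('X^i *: 'X^j : {poly {poly k}}) :> D.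
Proof.
have wdj : wd ^+ j = ('X^j : {poly {poly k}}).
  by elim: j => // j IH; rewrite exprS IH wdM -wder_iter1 -iterS wder_iter1.
have tM (P : D) : wt * P = ('X : {poly k}) *: (P : {poly {poly k}}).
  by rewrite /GRing.mul /= /wmul size_polyC polyX_eq0 big_ord1 /= coefC eqxx.
elim: i => [|i IH]; first by rewrite mul1r wdj scale1r.
by rewrite exprS -mulrA IH tM scalerA -exprS.
Qed.

Lemma wcoefD P Q i j : wcoef (P + Q) i j = wcoef P i j + wcoef Q i j.
Proof. by rewrite /wcoef -!coefD. Qed.

Lemma wcoef_sum (I : Type) (r : seq I) (p : pred I) (F : I -> D) i j :
  wcoef (\sum_(x <- r | p x) F x) i j = \sum_(x <- r | p x) wcoef (F x) i j.
Proof.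
apply: (big_morph (fun P => wcoef P i j)) => [P Q|]; last by rewrite /wcoef !coef0.
exact: wcoefD.
Qed.

Lemma wcoefB P Q i j : wcoef (P - Q) i j = wcoef P i j - wcoef Q i j.
Proof. by rewrite /wcoef -!coefB. Qed.

Lemma wcoefZ (c : k) P i j : wcoef (c *: P) i j = c * wcoef P i j.
Proof. by rewrite /wcoef -coefCM -coefZ. Qed.

Lemma wcoef0 i j : wcoef 0 i j = 0.
Proof. by rewrite /wcoef !coef0. Qed.

Lemma weylE (P : D) :
  P = \sum_(j < size (P : {poly {poly k}}))
        \sum_(i < size (P : {poly {poly k}})`_j)
          wcoef P i j *: (wt ^+ i * wd ^+ j).
Proof.
rewrite -{1}[P]coefK poly_def; apply: eq_bigr => j _.
rewrite -{1}[P`_j]coefK poly_def scaler_suml; apply: eq_bigr => i _.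
by rewrite wtMd -[P`_j`_i *: 'X^i]mul_polyC; exact: (esym (@scalerA {poly k} {poly {poly k}} (P`_j`_i)%:P 'X^i 'X^j)).
Qed.

(* D_n, the span of the t^i ∂^j with i - j = n *)
Definition homog (n : int) : {pred D} :=
  fun P => `[< forall i j : nat, i%:Z - j%:Z != n -> wcoef P i j = 0 >].

Lemma homogP n P :
  reflect (forall i j : nat, i%:Z - j%:Z != n -> wcoef P i j = 0) (P \in homog n).
Proof. exact: asboolP. Qed.

Lemma homog_zmod_closed n : zmod_closed (homog n).
Proof.
split=> [|P Q /homogP hP /homogP hQ]; apply/homogP=> i j ij; first exact: wcoef0.
by rewrite wcoefB hP // hQ // subr0.
Qed.
HB.instance Definition _ n := GRing.isZmodClosed.Build D (homog n)
  (homog_zmod_closed n).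

Lemma homogM a b P Q : P \in homog a -> Q \in homog b -> P * Q \in homog (a + b).
Proof.
move=> /homogP hP hQ.
have hD n (R : D) : R \in homog n -> wd * R \in homog (n - 1).
  move=> /homogP hR; apply/homogP => i j ij; rewrite wdM /wcoef coef_wder coefD.
  rewrite coef_deriv [X in X *+ _]hR ?mul0rn ?addr0; last first.
    by apply: contra ij => /eqP <-; rewrite -addn1 PoszD addrAC addrK.
  case: j ij => [|j] ij; first by rewrite coef0.
  apply: hR; apply: contra ij => /eqP <-.
  by rewrite -addn1 PoszD opprD addrA.
have hI i : iter i (@wder k) Q \in homog (b - i%:Z).
  elim: i => [|i IH]; first by rewrite subr0.
  by rewrite iterS -wdM -addn1 PoszD opprD addrA; exact: hD.
apply/homogP=> u v uv; rewrite /GRing.mul /= /wmul wcoef_sum big1 // => i _.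
rewrite /wcoef coefZ coefM big1 // => l _.
have [e1|] := eqVneq (l%:Z - i%:Z) a; last by move/hP; rewrite /wcoef => ->; rewrite mul0r.
have /homogP/(_ (u - l)%N v) := hI i; rewrite /wcoef => ->; first by rewrite mulr0.
apply: contra uv => /eqP e2; rewrite -e1 -[b](subrK i%:Z) -e2.
have le_lu : (l <= u)%N by rewrite -ltnS.
rewrite -{1}(subnK le_lu) PoszD [X in _ == X]addrC.
by rewrite [X in _ == X]addrACA subrr addr0 addrAC.
Qed.

Lemma homog1 : 1 \in homog 0.
Proof.
apply/homogP=> i j; rewrite /wcoef coefC; case: j => [|j] /=; last by rewrite coef0.
by rewrite coef1; case: i.
Qed.

Lemma homogZ n (c : k) P : P \in homog n -> c *: P \in homog n.
Proof.
move=> /homogP hP; apply/homogP=> i j ij.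
by rewrite wcoefZ hP ?mulr0.
Qed.

Lemma homog_t : wt \in homog 1.
Proof.
apply/homogP=> i j; rewrite /wcoef coefC; case: j => [|j] /=; last by rewrite coef0.
by rewrite coefX; case: i => [|[|i]].
Qed.

Lemma homog_d : wd \in homog (-1).
Proof.
apply/homogP=> i j; rewrite /wcoef coefX; case: j => [|[|j]] /=; rewrite ?coef0 //.
by rewrite coef1; case: i.
Qed.

Lemma homog_E : wE \in homog 0.
Proof. by rewrite -[0](subrr 1); apply: homogM homog_t homog_d. Qed.

Lemma homogX n P : P \in homog 0 -> P ^+ n \in homog 0.
Proof.
move=> hP; elim: n => [|n IH]; first exact: homog1.
by rewrite exprS -[0](addr0 0); apply: homogM.
Qed.

Definition wcomp (n : int) (P : D) : D :=
  \poly_(j < size (P : {poly {poly k}}))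
    \poly_(i < size (P : {poly {poly k}})`_j)
      (if i%:Z - j%:Z == n then wcoef P i j else 0).

Lemma wcoef_comp n P i j :
  wcoef (wcomp n P) i j = if i%:Z - j%:Z == n then wcoef P i j else 0.
Proof.
rewrite {1}/wcoef coef_poly; case: ltnP => [_|le_j].
  rewrite coef_poly; case: ltnP => // le_i.
  by rewrite /wcoef (nth_default _ le_i) if_same.
by rewrite coef0 /wcoef [P`_j]nth_default // coef0 if_same.
Qed.

Lemma homog_comp n P : wcomp n P \in homog n.
Proof. by apply/homogP=> i j ij; rewrite wcoef_comp (negPf ij). Qed.

Lemma wcomp_id n P : P \in homog n -> wcomp n P = P.
Proof.
move/homogP=> hP; apply: weylP => i j; rewrite wcoef_comp.
by case: eqVneq => // /hP.
Qed.

Lemma wcomp_ne m n P : P \in homog m -> m != n -> wcomp n P = 0.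
Proof.
move=> /homogP hP ne; apply: weylP => i j; rewrite wcoef_comp wcoef0.
by case: eqVneq => // e; rewrite hP // e eq_sym.
Qed.

Lemma wcomp_zmod_morphism n : zmod_morphism (wcomp n).
Proof.
move=> P Q; apply: weylP => i j; rewrite wcoefB !wcoef_comp wcoefB.
by case: eqP => //; rewrite subr0.
Qed.
HB.instance Definition _ n :=
  GRing.isZmodMorphism.Build D D (wcomp n) (wcomp_zmod_morphism n).

Lemma wcomp_sum P : exists2 s : seq int, uniq s & P = \sum_(n <- s) wcomp n P.
Proof.
pose N := size (P : {poly {poly k}}).
pose M := (\max_(j < N) size ((P : {poly {poly k}})`_j)%R)%N.
pose s := undup [seq i%:Z - j%:Z | i <- iota 0 M, j <- iota 0 N].
exists s; first exact: undup_uniq.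
apply: weylP => i j; rewrite wcoef_sum; under eq_bigr do rewrite wcoef_comp.
have [zP|nzP] := eqVneq (wcoef P i j) 0.
  by rewrite zP big1 // => n _; rewrite if_same.
have lt_j : (j < N)%N.
  rewrite ltnNge; apply: contra nzP => le_j.
  by rewrite /wcoef [P`_j]nth_default // coef0.
have lt_i : (i < M)%N.
  apply: leq_trans (leq_bigmax (Ordinal lt_j)); rewrite /= ltnNge.
  by apply: contra nzP => le_i; rewrite /wcoef nth_default.
have s_ij : i%:Z - j%:Z \in s.
  by rewrite mem_undup; apply/allpairsP; exists (i, j); rewrite !mem_iota.
rewrite (bigD1_seq (i%:Z - j%:Z)) ?undup_uniq //= eqxx.
by rewrite big1 ?addr0 // => n; rewrite eq_sym => /negPf ->.
Qed.

Lemma wcomp_homog_sum (s : seq int) (f : int -> D) n :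
    uniq s -> (forall i, f i \in homog i) -> n \in s ->
  wcomp n (\sum_(i <- s) f i) = f n.
Proof.
move=> us hf sn; rewrite raddf_sum (bigD1_seq n) //= wcomp_id // big1 ?addr0 //.
by move=> i ne_i; apply: wcomp_ne (hf i) ne_i.
Qed.

Lemma wcompM n e P w : w \in homog e -> wcomp n (P * w) = wcomp (n - e) P * w.
Proof.
move=> hw; have [s us ->] := wcomp_sum P.
rewrite mulr_suml !raddf_sum mulr_suml; apply: eq_bigr => m _ /=.
have hm : wcomp m P * w \in homog (m + e) by apply: homogM (homog_comp m P) hw.
have [<-|ne] := eqVneq (m + e) n.
  by rewrite addrK (wcomp_id hm) (wcomp_id (homog_comp m P)).
rewrite (wcomp_ne hm ne) (wcomp_ne (homog_comp m P)) ?mul0r //.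
by apply: contra ne => /eqP ->; rewrite subrK.
Qed.

End WeylAlgebra.

Section LQuot.
Variables (R : pzRingType) (V : lmodType R) (I : {pred V}).

Definition submod_pred of submod_closed I : {pred V} := I.

Hypothesis I_submod : submod_closed I.
Local Notation J := (submod_pred I_submod).
HB.instance Definition _ := GRing.isSubmodClosed.Build R V J I_submod.

Definition lquot : Type := Quotient.quot J.
HB.instance Definition _ := GRing.Zmodule.on lquot.

Definition lpi (v : V) : lquot := \pi_(Quotient.quot J) v.

Lemma lpi_zmod_morphism : zmod_morphism lpi.
Proof. by move=> x y; rewrite /lpi raddfB. Qed.
HB.instance Definition _ :=
  GRing.isZmodMorphism.Build V lquot lpi lpi_zmod_morphism.

Lemma lpi_eq x y : (lpi x == lpi y) = (x - y \in J).
Proof. by rewrite Quotient.idealrBE. Qed.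

Lemma lpi_eq0 x : (lpi x == 0) = (x \in I).
Proof. by rewrite -(raddf0 lpi) lpi_eq subr0. Qed.

Lemma lpi_surj x : exists v, x = lpi v.
Proof. by exists (repr (x : Quotient.quot J)); rewrite /lpi reprK. Qed.

Definition lquot_scale (a : R) (x : lquot) : lquot :=
  lpi (a *: repr (x : Quotient.quot J)).

Lemma lquot_scaleE a v : lquot_scale a (lpi v) = lpi (a *: v).
Proof.
apply/eqP; rewrite /lquot_scale lpi_eq -scalerBr rpredZ // -lpi_eq.
by rewrite /lpi reprK.
Qed.

Lemma lquot_scaleA a b v : lquot_scale a (lquot_scale b v) = lquot_scale (a * b) v.
Proof. by have [u ->] := lpi_surj v; rewrite !lquot_scaleE scalerA. Qed.
Lemma lquot_scale1 : left_id 1 lquot_scale.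
Proof. by move=> v; have [u ->] := lpi_surj v; rewrite lquot_scaleE scale1r. Qed.
Lemma lquot_scaleDr : right_distributive lquot_scale +%R.
Proof.
move=> c u v; have [u' ->] := lpi_surj u; have [v' ->] := lpi_surj v.
by rewrite -raddfD !lquot_scaleE scalerDr raddfD.
Qed.
Lemma lquot_scaleDl v : {morph lquot_scale^~ v : a b / a + b}.
Proof.
move=> a b; have [u ->] := lpi_surj v.
by rewrite !lquot_scaleE scalerDl raddfD.
Qed.

HB.instance Definition _ := GRing.Zmodule_isLmodule.Build R lquot
  lquot_scaleA lquot_scale1 lquot_scaleDr lquot_scaleDl.

Lemma lpi_scalable : scalable lpi.
Proof. by move=> a v; rewrite -lquot_scaleE. Qed.
HB.instance Definition _ := GRing.isScalable.Build R V lquot *:%R lpi lpi_scalable.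

End LQuot.

(* Boolean predicates stand for arbitrary subsets (excluded middle).          *)
(* The pieces are additive subgroups; they are k-subspaces because k lies in  *)
(* D_0.                                                                       *)

Record is_grading (k : fieldType) (M : lmodType (weyl k))
    (piece : int -> {pred M}) : Prop := IsGrading {
  grading_zmod : forall i, zmod_closed (piece i);
  grading_act : forall i j P x,
    P \in homog i -> x \in piece j -> P *: x \in piece (i + j);
  grading_span : forall x, exists (s : seq int) (f : int -> M),
    [/\ uniq s, forall i, f i \in piece i & x = \sum_(i <- s) f i];
  grading_free : forall (s : seq int) (f : int -> M),
    uniq s -> (forall i, f i \in piece i) -> \sum_(i <- s) f i = 0 ->
    forall i, i \in s -> f i = 0
}.

Record grMod (k : fieldType) := GrMod {
  gr_sort :> lmodType (weyl k);
  piece : int -> {pred gr_sort};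
  pieceP : is_grading piece
}.

(* A submodule is graded when it contains the homogeneous components of each  *)
(* of its elements.                                                           *)
Record grSub (k : fieldType) (M : grMod k) := GrSub {
  gr_mem :> {pred M};
  gr_submod : submod_closed gr_mem;
  gr_comp : forall (s : seq int) (f : int -> M),
    uniq s -> (forall i, f i \in piece i) -> \sum_(i <- s) f i \in gr_mem ->
    forall i, i \in s -> f i \in gr_mem
}.

HB.instance Definition _ (k : fieldType) (M : grMod k) (N : grSub M) :=
  GRing.isSubmodClosed.Build (weyl k) M (gr_mem N) (gr_submod N).

Section GrConstructions.
Variable k : fieldType.
Implicit Types M : grMod k.

Section SubMod.
Variables (M : grMod k) (N : grSub M).

Definition sub_sort : Type := {x : M | x \in gr_mem N}.
HB.instance Definition _ := SubChoice.on sub_sort.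
HB.instance Definition _ := [SubChoice_isSubLmodule of sub_sort by <:].

Definition sub_piece (i : int) : {pred sub_sort} := [pred x | val x \in piece i].

Lemma sub_grading : is_grading sub_piece.
Proof.
have [pz pa ps pf] := pieceP M; split.
- move=> i; have [p0 pB] := pz i.
  by split=> [|x y]; rewrite !inE ?raddf0 ?raddfB //; exact: pB.
- by move=> i j P x hP; rewrite !inE linearZ; exact: pa.
- move=> x; have [s [f [us hf ex]]] := ps (val x).
  have Nf i : i \in s -> f i \in gr_mem N.
    by apply: gr_comp => //; rewrite -ex; exact: valP.
  pose g i : sub_sort := insubd 0 (if i \in s then f i else 0).
  have gE i : val (g i) = if i \in s then f i else 0.
    by rewrite val_insubd; case: (boolP (i \in s)) => [/Nf ->|_]; rewrite ?rpred0.
  exists s, g; split => // [i|].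
    by rewrite inE gE; case: ifP => // _; have [] := pz i.
  apply: val_inj; rewrite ex raddf_sum; apply: eq_big_seq => i si /=.
  by rewrite gE si.
- move=> s f us hf sf0 i si; apply: val_inj; rewrite raddf0.
  apply: (pf s (fun i => val (f i))) => //.
  by rewrite -raddf_sum sf0 raddf0.
Qed.

Definition grSubMod : grMod k := GrMod sub_grading.
End SubMod.

Section QuotMod.
Variables (M : grMod k) (N : grSub M).

Definition quot_piece (i : int) : {pred lquot (gr_submod N)} :=
  fun x => `[< exists2 v, v \in @piece k M i & x = lpi (gr_submod N) v >].

Lemma quot_grading : is_grading quot_piece.
Proof.
have [pz pa ps pf] := pieceP M; split.
- move=> i; have [p0 pB] := pz i; split=> [|x y].
    by apply/asboolP; exists 0; rewrite ?raddf0.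
  move=> /asboolP[u hu ->] /asboolP[v hv ->]; apply/asboolP.
  by exists (u - v); rewrite ?raddfB //; exact: pB.
- move=> i j P x hP /asboolP[v hv ->]; apply/asboolP.
  by exists (P *: v); rewrite ?linearZ //; exact: pa.
- move=> x; have [v ->] := lpi_surj x; have [s [f [us hf ->]]] := ps v.
  exists s, (fun i => lpi (gr_submod N) (f i)); split => // [i|].
    by apply/asboolP; exists (f i).
  by rewrite raddf_sum.
- move=> s f us hf sf0 i si.
  have /choice[g gP] : forall i, exists v, v \in @piece k M i /\ f i = lpi (gr_submod N) v.
    by move=> j; have /asboolP[v] := hf j; exists v.
  have Ng : \sum_(i <- s) g i \in gr_mem N.
    rewrite -(lpi_eq0 (gr_submod N)) raddf_sum; apply/eqP.
    by rewrite -[RHS]sf0; apply: eq_bigr => j _; have [] := gP j.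
  have [_ ->] := gP i; apply/eqP; rewrite lpi_eq0.
  by apply: gr_comp Ng i si => // j; have [] := gP j.
Qed.

Definition grQuot : grMod k := GrMod quot_grading.
End QuotMod.

Lemma weyl_grading : @is_grading k (weyl k)^o (@homog k).
Proof.
split.
- exact: homog_zmod_closed.
- by move=> i j P x; exact: homogM.
- move=> x; have [s us ex] := wcomp_sum x; exists s, (fun i => wcomp i x).
  by split => // i; exact: homog_comp.
- move=> s f us hf sf0 i si.
  by rewrite -(wcomp_homog_sum us hf si) sf0 raddf0.
Qed.

Definition grWeyl : grMod k := GrMod weyl_grading.

Section Principal.
Variable w : weyl k.

Definition principal : {pred grWeyl} := fun P => `[< exists Q : weyl k, P = Q * w >].

Lemma principal_submod : submod_closed principal.
Proof.
split=> [|a P P']; first by apply/asboolP; exists 0; rewrite mul0r.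
move=> /asboolP[Q ->] /asboolP[Q' ->]; apply/asboolP; exists (a * Q + Q').
by rewrite mulrDl -mulrA.
Qed.

Hypothesis hw : exists e, w \in homog e.

Lemma principal_comp (s : seq int) (f : int -> grWeyl) :
    uniq s -> (forall i, f i \in piece i) -> \sum_(i <- s) f i \in principal ->
  forall i, i \in s -> f i \in principal.
Proof.
have [e he] := hw; move=> us hf /asboolP[Q sfQ] i si.
apply/asboolP; exists (wcomp (i - e) Q).
by rewrite -(wcompM _ _ he) -sfQ (wcomp_homog_sum us hf si).
Qed.

Definition grPrincipal : grSub grWeyl := GrSub principal_submod principal_comp.
End Principal.

End GrConstructions.

Section Category.
Variable k : fieldType.
Implicit Types L M : grMod k.

Definition is_grHom L M (f : {linear L -> M}) : Prop :=
  exists d : int, forall i x, x \in piece i -> f x \in piece (i + d).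

Definition grIso L M : Prop :=
  exists (f : {linear L -> M}) (g : {linear M -> L}),
    [/\ is_grHom f, is_grHom g, cancel f g & cancel g f].

Definition grsub_le M (A B : grSub M) : Prop := {subset A <= B}.

(* A < B with nothing in between, i.e. B / A is a simple graded module *)
Definition grsub_cover M (A B : grSub M) : Prop :=
  [/\ grsub_le A B, ~ grsub_le B A &
      forall C : grSub M, grsub_le A C -> grsub_le C B ->
        grsub_le C A \/ grsub_le B C].

(* Graded holonomic means of finite length: there is a composition series of  *)
(* graded submodules.                                                         *)
Definition grHolonomic M : Prop :=
  exists (n : nat) (N : nat -> grSub M),
    [/\ gr_mem (N 0%N) =i pred1 0, gr_mem (N n) =i predT &
        forall i, (i < n)%N -> grsub_cover (N i) (N i.+1)].

Definition grDirectSum M (J : finType) (N : J -> grSub M) : Prop :=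
  forall x : M, exists! f : {ffun J -> M},
    (forall j, f j \in gr_mem (N j)) /\ x = \sum_j f j.

Definition grIndecomposable M : Prop :=
  (exists x : M, x != 0) /\
  forall A B : grSub M, grDirectSum (fun b : bool => if b then A else B) ->
    gr_mem A =i pred1 0 \/ gr_mem B =i pred1 0.

Definition grUniserial M : Prop :=
  forall A B : grSub M, grsub_le A B \/ grsub_le B A.

Definition grHol_uniserial : Prop :=
  forall M, grHolonomic M -> grIndecomposable M -> grUniserial M.

End Category.

Section Modules.
Variable k : fieldType.

(* The alternating word of length n in x and y ending, on the right, in x *)
Fixpoint altword (x y : weyl k) (n : nat) : weyl k :=
  if n is n'.+1 then altword y x n' * x else 1.

Definition Mgen (alpha : k) (n : nat) : weyl k :=
  if alpha == 0 then altword (wd k) (wt k) n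
  else if alpha == 1 then altword (wt k) (wd k) n
  else (wE k - alpha%:A) ^+ n.

Lemma altword_homog n (x y : weyl k) :
  (exists e, x \in homog e) -> (exists e, y \in homog e) ->
  exists e, altword x y n \in homog e.
Proof.
elim: n x y => [|n IH] x y hx hy; first by exists 0; exact: homog1.
have [e he] := IH y x hy hx; have [a ha] := hx.
by exists (e + a); apply: homogM.
Qed.

Lemma Mgen_homog alpha n : exists e, Mgen alpha n \in homog e.
Proof.
have ht : exists e, wt k \in homog e by exists 1; exact: homog_t.
have hd : exists e, wd k \in homog e by exists (-1); exact: homog_d.
rewrite /Mgen; case: eqP => _; first exact: altword_homog.
case: eqP => _; first exact: altword_homog.
exists 0; apply: homogX; rewrite rpredB ?homog_E //.
by apply: homogZ; exact: homog1.
Qed.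

Definition grM (alpha : k) (n : nat) : grMod k :=
  grQuot (grPrincipal (Mgen_homog alpha n)).

Definition kint : {pred k} := fun x => `[< exists m : int, x = m%:~R >].

Lemma kint_zmod_closed : zmod_closed kint.
Proof.
split=> [|x y /asboolP[m ->] /asboolP[n ->]]; apply/asboolP; first by exists 0.
by exists (m - n); rewrite rmorphB.
Qed.
HB.instance Definition _ := GRing.isZmodClosed.Build k kint kint_zmod_closed.

Definition kmodZ : Type := Quotient.quot kint.
Definition to_kmodZ (x : k) : kmodZ := \pi_(Quotient.quot kint) x.

End Modules.

(* Main.v *)
From HB Require Import structures.
Require Import Defs.
From mathcomp Require Import all_boot all_order all_algebra.
From mathcomp Require Import boolp classical_sets functions.

Set Implicit Arguments.
Unset Strict Implicit.
Unset Printing Implicit Defensive.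
Import GRing.Theory.
Local Open Scope ring_scope.

(** Write [E = t d].  Since [P E = (E - e) P] for [P] of degree [e], a graded
    module splits along the classes of (eigenvalue of [E]) - (degree), and on
    each class the letters [t] and [d] move a generalized eigenvector from one
    eigenvalue to the next.  They are invertible there, except between the
    eigenvalues [-1] and [0], where [t d] and [d t] are nilpotent.  So a module
    of finite length is a finite direct sum of modules, each determined by a
    nilpotent representation of a quiver: one vertex and one loop [E - a] for a
    non-integral class, two vertices in a cycle with arrows [d] and [t] for the
    integral class.  Those representations are serial.

    The proof never passes to quiver representations.  A vector is called typed
    at [a] (predicate [typed]) when it is homogeneous and a generalized
    eigenvector of [E] for the eigenvalue [ev a]; [step a] is the arrow leaving
    [a], and the word [Mgen a n] is a product of [n] successive arrows starting
    at [a].  Three facts carry everything: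

    - [D / D (step a)] is a simple graded module ([step_maximal]).  Together
      with nilpotency ([nakayama]) this gives [typed_dichotomy]: a homogeneous
      multiple of a typed vector [v] either generates [v] again or comes from
      [D (step a)].  Hence the graded submodules of [D v] form a chain
      ([cyc_chain]), successive members of which have simple quotients
      ([cyc_cover]), and the annihilator of [v] is generated by a word
      ([annihilator]), which identifies [D v] with some [M(a, n)].

    - In a module of finite length every homogeneous vector is killed by a
      nonzero polynomial in [E] ([finite_length_loc_fin]), so over an
      algebraically closed field typed vectors generate every graded submodule
      ([typed_generation]).

    - A typed vector [v] of maximal length generates a direct summand
      ([cyclic_summand]): the argument is the one for nilpotent endomorphisms,
      a submodule maximal among those that meet [D v] trivially is a complement.

    Splitting off such summands gives the decomposition; an indecomposable
    module is a single summand, hence uniserial.  Conversely the generator of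
    [M(a, n)] has length exactly [n] because [D] is a domain in which no [step]
    is invertible ([Mgen_strict]). *)

(** * The Euler operator and the homogeneous components of the Weyl algebra *)

Section EulerOperator.
Variable k : fieldType.
Local Notation D := (weyl k).
Local Notation t := (wt k).
Local Notation d := (wd k).
Local Notation E := (wE k).
Local Notation ofE := (horner_alg (wE k)).

Lemma weyl_Et : E * t = t * (E + 1).
Proof. by rewrite -mulrA wdt. Qed.

Lemma weyl_Ed : E * d = d * (E - 1).
Proof. by rewrite mulrBr mulrA wdt mulrDl mul1r mulr1 addrK. Qed.

Lemma homog_ind (e : int) (P : D -> Prop) :
    P 0 -> (forall x y, P x -> P y -> P (x + y)) ->
    (forall c i j, i%:Z - j%:Z = e -> P (c *: (t ^+ i * d ^+ j))) ->
  forall W, W \in homog e -> P W.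
Proof.
move=> P0 PD PZ W /homogP hW; rewrite [W]weylE.
elim/big_ind: _ => // j _; elim/big_ind: _ => // i _.
have [/PZ//|ne] := eqVneq (i%:Z - j%:Z) e.
by rewrite hW // scale0r.
Qed.

Lemma weyl_tnE n : t ^+ n * E = (E - n%:R) * t ^+ n.
Proof.
elim: n => [|n IH]; first by rewrite subr0 mulr1 mul1r.
rewrite exprS -mulrA IH mulrA mulrA; congr (_ * _).
rewrite mulrBl weyl_Et -(commr_nat t) -mulrBr -natr1 opprD.
by rewrite addrACA subrr addr0.
Qed.

Lemma weyl_dnE n : d ^+ n * E = (E + n%:R) * d ^+ n.
Proof.
elim: n => [|n IH]; first by rewrite addr0 mulr1 mul1r.
rewrite exprS -mulrA IH mulrA mulrA; congr (_ * _).
by rewrite mulrDl weyl_Ed -(commr_nat d) -mulrDr -natr1 addrACA addNr addr0.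
Qed.

(** The commutation rule behind the splitting of graded modules along the
    eigenvalues of [E]. *)
Lemma homog_mulE e (W : D) : W \in homog e -> W * E = (E - e%:~R) * W.
Proof.
elim/homog_ind => [|x y IHx IHy|c i j <-]; first by rewrite mul0r mulr0.
  by rewrite mulrDl mulrDr IHx IHy.
rewrite -scalerAl -scalerAr; congr (_ *: _).
rewrite -mulrA weyl_dnE mulrA mulrDr weyl_tnE commr_nat -mulrDl -mulrA.
by rewrite rmorphB opprB addrA addrAC.
Qed.

Lemma homog_ofE e (W : D) f : W \in homog e ->
  W * ofE f = ofE (f \Po ('X - e%:~R%:P)) * W.
Proof.
move=> hW; elim/poly_ind: f => [|f c IH].
  by rewrite comp_poly0 !rmorph0 mulr0 mul0r.
rewrite comp_poly_MXaddC !rmorphD !rmorphM /= !horner_algX !horner_algC.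
rewrite mulrDr mulrA IH mulrDl; congr (_ + _).
  rewrite -[LHS]mulrA (homog_mulE hW) mulrA; congr (_ * _ * _).
  by rewrite rmorphB /= horner_algX horner_algC scaler_int.
by rewrite -scalerAr mulr1 -scalerAl mul1r.
Qed.

Lemma ofE_homog0 f : ofE f \in homog 0.
Proof.
elim/poly_ind: f => [|f c IH]; first by rewrite rmorph0 rpred0.
rewrite rmorphD rmorphM /= horner_algX horner_algC rpredD //.
  by rewrite -[0]addr0 homogM ?homog_E.
exact/homogZ/homog1.
Qed.

Lemma homog_exp e n (W : D) : W \in homog e -> W ^+ n \in homog (e *+ n).
Proof.
move=> hW; elim: n => [|n IH]; first exact: homog1.
by rewrite exprS mulrS homogM.
Qed.

Lemma weyl_tndn n : exists f, t ^+ n * d ^+ n = ofE f.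
Proof.
elim: n => [|n [f IH]]; first by exists 1; rewrite mulr1 rmorph1.
exists ((f \Po ('X - 1%:~R%:P)) * 'X).
rewrite exprS exprSr -!mulrA [X in _ * X]mulrA IH mulrA.
by rewrite (homog_ofE _ (homog_t k)) rmorphM /= horner_algX mulrA.
Qed.

(** Every product [t^j d^j] is a polynomial in [E], and polynomials in [E] can
    be moved past powers of [t] and of [d]; so each homogeneous component of [D]
    is a cyclic [k[E]]-module. *)
Lemma homog_pos n (W : D) : W \in homog n%:Z -> exists f, W = ofE f * t ^+ n.
Proof.
elim/homog_ind => [|x y [f ->] [g ->]|c i j ij].
- by exists 0; rewrite rmorph0 mul0r.
- by exists (f + g); rewrite rmorphD mulrDl.
have -> : i = (n + j)%N by apply/eqP; rewrite -eqz_nat PoszD -ij subrK.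
have [f hf] := weyl_tndn j.
exists (c *: (f \Po ('X - (1 *+ n)%:~R%:P))).
rewrite exprD -mulrA hf (homog_ofE _ (homog_exp n (homog_t k))).
by rewrite linearZ /= -scalerAl scalerAl mulr_algl scalerAl.
Qed.

Lemma homog_neg n (W : D) : W \in homog (- n%:Z) ->
  exists f, W = ofE f * d ^+ n.
Proof.
elim/homog_ind => [|x y [f ->] [g ->]|c i j ij].
- by exists 0; rewrite rmorph0 mul0r.
- by exists (f + g); rewrite rmorphD mulrDl.
have -> : j = (i + n)%N.
  apply/eqP; rewrite -eqz_nat PoszD -[X in _ + X]opprK -ij opprB addrCA.
  by rewrite subrr addr0.
have [f hf] := weyl_tndn i; exists (c *: f).
by rewrite exprD mulrA hf linearZ /= mulr_algl scalerAl.
Qed.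

Lemma homog_zero (W : D) : W \in homog 0 -> exists f, W = ofE f.
Proof. by move=> /(@homog_pos 0)[f ->]; exists f; rewrite mulr1. Qed.

End EulerOperator.

(** * The letters as steps between vertices *)

Section Steps.
Variable k : fieldType.
Hypothesis k_char0 : [pchar k] =i pred0.
Local Notation D := (weyl k).
Local Notation t := (wt k).
Local Notation d := (wd k).
Local Notation E := (wE k).
Local Notation ofE := (horner_alg (wE k)).
Implicit Types a b : k.

(** The index [a] is regarded as a vertex of a quiver: [step a] is the arrow
    leaving it, [nxt a] the vertex it reaches, [deg a] its degree in [D]. *)
Definition step a : D := if a == 0 then d else if a == 1 then t else E - a%:A.
Definition nxt a : k := if a == 0 then 1 else if a == 1 then 0 else a.
Definition deg a : int := if a == 0 then -1 else if a == 1 then 1 else 0.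

(** The eigenvalue of [E] on the generator of [M(a, n)]; for [a = 1] the
    relation [t v = 0] gives [(E + 1) v = d t v = 0]. *)
Definition ev a : k := if a == 1 then -1 else a.

(** [E - ev a] factors as [ret a * step a] and as [step (nxt a) * cor a]. *)
Definition ret a : D := if a == 0 then t else if a == 1 then d else 1.
Definition cor a : D := if a == 0 then d else if a == 1 then t else 1.

Definition adm a : Prop := [\/ a = 0, a = 1 | a \notin @kint k].

Lemma nxtK : involutive nxt.
Proof.
move=> a; rewrite /nxt; have [->|a0] := eqVneq a 0.
  by rewrite oner_eq0 eqxx.
by have [->|a1] := eqVneq a 1; rewrite ?eqxx // (negPf a0) (negPf a1).
Qed.

Lemma Mgen_rec a n : Mgen a n.+1 = Mgen (nxt a) n * step a.
Proof.
rewrite /Mgen /nxt /step; have [_|a0] := eqVneq a 0.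
  by rewrite oner_eq0 eqxx.
have [_|a1] := eqVneq a 1; first by rewrite eqxx.
by rewrite (negPf a0) (negPf a1) exprSr.
Qed.

Lemma Mgen0 a : Mgen a 0 = 1.
Proof. by rewrite /Mgen; case: eqP => // _; case: eqP. Qed.

Lemma Mgen_add a m n : Mgen a (m + n) = Mgen (iter n nxt a) m * Mgen a n.
Proof.
elim: n a => [|n IH] a; first by rewrite addn0 Mgen0 mulr1.
by rewrite addnS !Mgen_rec IH mulrA iterSr.
Qed.

Lemma Mgen1 a : Mgen a 1 = step a.
Proof. by rewrite Mgen_rec Mgen0 mul1r. Qed.

Lemma step_homog a : step a \in homog (deg a).
Proof.
rewrite /step /deg; case: eqP => _; first exact: homog_d.
case: eqP => _; first exact: homog_t.
by rewrite rpredB ?homog_E ?homogZ ?homog1.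
Qed.

Lemma cor_homog a : cor a \in homog (deg a).
Proof.
rewrite /cor /deg; case: eqP => _; first exact: homog_d.
by case: eqP => _; [exact: homog_t | exact: homog1].
Qed.

Lemma ofE_lin a : ofE ('X - a%:P) = E - a%:A.
Proof. by rewrite rmorphB /= horner_algX horner_algC. Qed.

Lemma ret_step a : ofE ('X - (ev a)%:P) = ret a * step a.
Proof.
rewrite ofE_lin /ev /ret /step; have [->|a0] := eqVneq a 0.
  by rewrite eq_sym oner_eq0 scale0r subr0.
have [_|_] := eqVneq a 1; last by rewrite mul1r.
by rewrite wdt scaleN1r opprK.
Qed.

Lemma step_cor a : ofE ('X - (ev a)%:P) = step (nxt a) * cor a.
Proof.
rewrite ofE_lin /ev /cor /step /nxt; have [->|a0] := eqVneq a 0.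
  by rewrite oner_eq0 eqxx eq_sym oner_eq0 scale0r subr0.
have [_|a1] := eqVneq a 1; first by rewrite eqxx wdt scaleN1r opprK.
by rewrite (negPf a0) (negPf a1) mulr1.
Qed.

Lemma ev_nxt a : ev (nxt a) = ev a + (deg a)%:~R.
Proof.
rewrite /ev /nxt /deg; have [->|a0] := eqVneq a 0.
  by rewrite eqxx eq_sym oner_eq0 add0r rmorphN1.
case: (eqVneq a 1) => [_|a1]; last by rewrite (negPf a1) addr0.
by rewrite eq_sym oner_eq0 addNr.
Qed.

Lemma homog_ret a (W : D) : W \in homog (- deg a) ->
  exists f, W = ofE f * ret a.
Proof.
rewrite /deg /ret; case: eqP => _; first by move/(@homog_pos _ 1).
case: eqP => _; first by move/(@homog_neg _ 1).
by rewrite oppr0 => /homog_zero [f ->]; exists f; rewrite mulr1.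
Qed.

Lemma intr_inj_char0 (m n : int) : m%:~R = n%:~R :> k -> m = n.
Proof.
have nat0 (p : nat) : p%:R = 0 :> k -> p = 0%N.
  by move/eqP; rewrite (proj1 (GRing.pcharf0P k) k_char0) => /eqP.
move/eqP; rewrite -subr_eq0 -rmorphB /= => /eqP mn0.
apply/eqP; rewrite -subr_eq0.
case: (m - n) mn0 => p; first by move/nat0 ->.
by rewrite NegzE rmorphN => /eqP; rewrite oppr_eq0 => /eqP/nat0.
Qed.

Lemma ev_int a (m : int) : adm a -> ev a = m%:~R ->
  (a = 0 /\ m = 0) \/ (a = 1 /\ m = -1).
Proof.
rewrite /ev => -[->|->|na].
- rewrite eq_sym oner_eq0 => e; left; split => //.
  by apply: intr_inj_char0; rewrite -e.
- rewrite eqxx => e; right; split => //; apply: intr_inj_char0.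
  by rewrite -e rmorphN1.
have [a1 _|_ e] := eqVneq a 1.
  by case/negP: na; apply/asboolP; exists 1; rewrite a1.
by case/negP: na; apply/asboolP; exists m.
Qed.

(** [E - ev a] is a left multiple of [step a], so [E] can be replaced by the
    scalar [ev a] modulo [D (step a)]. *)
Lemma ofE_mod_step a f : exists G, ofE f = (f.[ev a])%:A + G * step a.
Proof.
have : root (f - (f.[ev a])%:P) (ev a) by rewrite rootE !hornerE subrr.
case/factor_theorem => g e; exists (ofE g * ret a).
rewrite -mulrA -ret_step -rmorphM -e rmorphB /= horner_algC.
by rewrite addrCA subrr addr0.
Qed.

Lemma homog_ofEr e (W : D) f : W \in homog e ->
  ofE f * W = W * ofE (f \Po ('X + e%:~R%:P)).
Proof.
move=> hW; rewrite (homog_ofE _ hW) -comp_polyA; congr (ofE _ * _).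
by rewrite comp_polyD comp_polyX comp_polyC subrK comp_polyXr.
Qed.

(** [P] generates [D / D (step a)]. *)
Definition left_inv_mod a (P : D) : Prop :=
  exists R S : D, 1 = R * P + S * step a.

Lemma left_inv_mod1 a : left_inv_mod a 1.
Proof. by exists 1, 0; rewrite mulr1 mul0r addr0. Qed.

Lemma left_inv_modZ a c (P Q S R : D) : c != 0 -> left_inv_mod a P ->
  R * Q = c *: P + S * step a -> left_inv_mod a Q.
Proof.
move=> c0 [R' [S' e1]] e.
exists (R' * (c^-1 *: R)), (S' - R' * (c^-1 *: S)).
rewrite [LHS]e1 -mulrA -scalerAl e scalerDr scalerA mulVf // scale1r mulrDr.
rewrite mulrBl -mulrA -scalerAl -addrA; congr (_ + _).
by rewrite addrCA subrr addr0.
Qed.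

(** [d t^(n+1) = t^n (E + n + 1)], and [ev a + n + 1] vanishes only when
    [a = 1], where [ev a = -1]. *)
Lemma left_inv_t a n : adm a -> a != 1 -> left_inv_mod a (t ^+ n).
Proof.
move=> ha a1; elim: n => [|n IH]; first exact: left_inv_mod1.
have [G hG] := ofE_mod_step a (('X + 1) \Po ('X + (1 *+ n)%:~R%:P)).
have e : d * t ^+ n.+1 = t ^+ n * ofE (('X + 1) \Po ('X + (1 *+ n)%:~R%:P)).
  rewrite exprS mulrA -(homog_ofEr _ (homog_exp n (homog_t k))); congr (_ * _).
  by rewrite rmorphD /= horner_algX rmorph1 wdt.
move: e; rewrite hG mulrDr mulr_algr mulrA; apply: left_inv_modZ IH.
rewrite horner_comp !hornerE; apply/eqP => e.
have : ev a = (- (n%:Z + 1))%:~R.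
  by apply/eqP; rewrite -subr_eq0 rmorphN rmorphD /= opprK addrA -natz e.
case/(ev_int ha) => -[ae]; last by rewrite ae eqxx in a1.
by move/eqP; rewrite oppr_eq0 -PoszD addn1.
Qed.

(** [t d^(n+1) = d^n (E - n)], and [ev a - n] vanishes only when [a = 0]. *)
Lemma left_inv_d a n : adm a -> a != 0 -> left_inv_mod a (d ^+ n).
Proof.
move=> ha a0; elim: n => [|n IH]; first exact: left_inv_mod1.
have [G hG] := ofE_mod_step a ('X \Po ('X + (-1 *+ n)%:~R%:P)).
have e : t * d ^+ n.+1 = d ^+ n * ofE ('X \Po ('X + (-1 *+ n)%:~R%:P)).
  rewrite exprS mulrA -(homog_ofEr _ (homog_exp n (homog_d k))); congr (_ * _).
  by rewrite horner_algX.
move: e; rewrite hG mulrDr mulr_algr mulrA; apply: left_inv_modZ IH.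
rewrite horner_comp !hornerE; apply/eqP => e.
have : ev a = n%:~R.
  by apply/eqP; rewrite -subr_eq0 -natz -rmorphN /= -mulNrn e.
case/(ev_int ha) => -[ae]; first by rewrite ae eqxx in a0.
by [].
Qed.

(** [D / D (step a)] is spanned by the powers of [t] and of [d], and from each
    power that survives the opposite letter leads back to the generator, with
    nonzero coefficients in characteristic 0; so it is graded-simple. *)
Lemma step_maximal a m (Q : D) : adm a -> Q \in homog m ->
  (exists R, Q = R * step a) \/ left_inv_mod a Q.
Proof.
move=> ha.
have main e (W : D) f : W \in homog e ->
    (exists R, W = R * step a) \/ left_inv_mod a W ->
    Q = ofE f * W -> (exists R, Q = R * step a) \/ left_inv_mod a Q.
  move=> hW [[R ->] ->|iW]; first by left; exists (ofE f * R); rewrite mulrA.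
  rewrite (homog_ofEr _ hW); move: (_ \Po _) => g eQ.
  have [G hG] := ofE_mod_step a g.
  move: eQ; rewrite hG mulrDr mulr_algr mulrA.
  have [-> eQ|g0 eQ] := eqVneq g.[ev a] 0.
    by left; exists (W * G); rewrite eQ scale0r add0r.
  right; apply: (@left_inv_modZ a g.[ev a] W Q (W * G) 1 g0 iW).
  by rewrite mul1r.
case: m => n.
  case/homog_pos => f; apply: main (homog_exp n (homog_t k)) _.
  have [a1|a1] := eqVneq a 1; last by right; exact: left_inv_t.
  case: n => [|n]; first by right; exact: left_inv_mod1.
  by left; exists (t ^+ n); rewrite exprSr /step a1 oner_eq0 eqxx.
rewrite NegzE => /homog_neg[f]; apply: main (homog_exp n.+1 (homog_d k)) _.
have [a0|a0] := eqVneq a 0; last by right; exact: left_inv_d.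
by left; exists (d ^+ n); rewrite exprSr /step a0 eqxx.
Qed.

End Steps.

(** * Homogeneous components and graded submodules *)

Section HomogeneousComponents.
Variable k : fieldType.
Variable M : grMod k.
Local Notation D := (weyl k).
Implicit Types (x y v : M) (A B : grSub M).

Lemma sum_support (s S : seq int) (f : int -> M) :
    uniq s -> uniq S -> {subset s <= S} ->
  \sum_(i <- S) (if i \in s then f i else 0) = \sum_(i <- s) f i.
Proof.
move=> us uS sS; rewrite -big_mkcond -big_filter; apply: perm_big.
apply: uniq_perm; rewrite ?filter_uniq // => i; rewrite mem_filter.
by case: (boolP (i \in s)) => // /sS.
Qed.

(** The two families are compared on the union of their supports, together with
    [i] itself, which may lie in neither. *)
Lemma components_unique (s s' : seq int) (f f' : int -> M) i :
    uniq s -> uniq s' -> (forall i, f i \in piece i) ->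
    (forall i, f' i \in piece i) -> \sum_(i <- s) f i = \sum_(i <- s') f' i ->
  (if i \in s then f i else 0) = (if i \in s' then f' i else 0).
Proof.
move=> us us' hf hf' e; pose S := undup (i :: s ++ s').
pose g j := (if j \in s then f j else 0) - (if j \in s' then f' j else 0).
have [pz _ _ pf] := pieceP M.
apply/eqP; rewrite -subr_eq0; apply/eqP; apply: (pf S g).
- exact: undup_uniq.
- move=> j; have [p0 pB] := pz j; apply: pB; case: ifP => // _; exact: hf'.
- rewrite sumrB !sum_support ?undup_uniq ?e ?subrr // => j js;
    by rewrite mem_undup inE mem_cat js !orbT.
- by rewrite mem_undup inE eqxx.
Qed.

Lemma components_exist x : exists c : int -> M, exists s : seq int,
  [/\ uniq s, forall i, c i \in piece i, forall i, i \notin s -> c i = 0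
    & x = \sum_(i <- s) c i].
Proof.
have [pz _ ps _] := pieceP M; have [s [f [us hf ->]]] := ps x.
exists (fun i => if i \in s then f i else 0), s; split => //.
- by move=> i; have [p0 _] := pz i; case: ifP.
- by move=> i /negPf ->.
- by rewrite big_seq [RHS]big_seq; apply: eq_bigr => i ->.
Qed.

Definition hcomp i x : M := projT1 (cid (components_exist x)) i.

Lemma hcompE (s : seq int) (f : int -> M) i :
    uniq s -> (forall i, f i \in piece i) ->
  hcomp i (\sum_(i <- s) f i) = if i \in s then f i else 0.
Proof.
move=> us hf; rewrite /hcomp; case: cid => c /= [s' [us' hc c0 e]].
have := components_unique i us us' hf hc e => ->.
by case: ifPn => // /c0.
Qed.

Lemma hcomp_piece i x : hcomp i x \in piece i.
Proof. by rewrite /hcomp; case: cid => c /= [s' []]. Qed.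

Lemma hcomp_sum x : exists2 s, uniq s & x = \sum_(i <- s) hcomp i x.
Proof.
rewrite /hcomp; case: cid => c /= [s [us hc c0 e]]; by exists s.
Qed.

Lemma piece_zmod i : zmod_closed (@piece k M i).
Proof. by have [pz _ _ _] := pieceP M. Qed.

HB.instance Definition _ i :=
  GRing.isZmodClosed.Build M (@piece k M i) (piece_zmod i).

Lemma piece_act i j (P : D) x : P \in homog i -> x \in piece j ->
  P *: x \in piece (i + j).
Proof. by have [_ pa _ _] := pieceP M; exact: pa. Qed.

Lemma hcomp_id i x : x \in piece i -> hcomp i x = x.
Proof.
move=> hx; pose f j := if j == i then x else 0 : M.
have {1}-> : x = \sum_(j <- [:: i]) f j by rewrite big_seq1 /f eqxx.
rewrite hcompE // ?inE ?eqxx /f ?eqxx // => j.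
by case: eqP => [->|_]; rewrite ?rpred0.
Qed.

Lemma hcomp_ne i j x : x \in piece i -> j != i -> hcomp j x = 0.
Proof.
move=> hx ne; pose f j := if j == i then x else 0 : M.
have -> : x = \sum_(j <- [:: i]) f j by rewrite big_seq1 /f eqxx.
rewrite hcompE // ?inE ?(negPf ne) // /f => l.
by case: eqP => [->|_]; rewrite ?rpred0.
Qed.

Lemma hcomp_zmod_morphism i : zmod_morphism (hcomp i).
Proof.
move=> x y; have [s us ex] := hcomp_sum x; have [s' us' ey] := hcomp_sum y.
pose S := undup (i :: s ++ s').
pose f j := (if j \in s then hcomp j x else 0)
            - (if j \in s' then hcomp j y else 0).
have e : x - y = \sum_(j <- S) f j.
  rewrite sumrB !sum_support ?undup_uniq -?ex -?ey // => j js;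
    by rewrite mem_undup inE mem_cat js !orbT.
rewrite e hcompE ?undup_uniq //; last first.
  by move=> j; rewrite rpredB //; case: ifP; rewrite ?rpred0 ?hcomp_piece.
have hx : hcomp i x = if i \in s then hcomp i x else 0.
  by rewrite {1}ex hcompE // => j; exact: hcomp_piece.
have hy : hcomp i y = if i \in s' then hcomp i y else 0.
  by rewrite {1}ey hcompE // => j; exact: hcomp_piece.
by rewrite mem_undup inE eqxx /f -hx -hy.
Qed.

HB.instance Definition _ i :=
  GRing.isZmodMorphism.Build M M (hcomp i) (hcomp_zmod_morphism i).

Lemma hcomp_act e i (P : D) x : P \in homog e ->
  hcomp i (P *: x) = P *: hcomp (i - e) x.
Proof.
move=> hP; have [s us ex] := hcomp_sum x.
rewrite {1}ex scaler_sumr raddf_sum /= {2}ex raddf_sum scaler_sumr.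
apply: eq_bigr => j _ /=.
have hj : P *: hcomp j x \in piece (e + j) := piece_act hP (hcomp_piece j x).
have [->|ne] := eqVneq i (e + j).
  by rewrite (hcomp_id hj) addrAC subrr add0r (hcomp_id (hcomp_piece j x)).
rewrite (hcomp_ne hj ne) (hcomp_ne (hcomp_piece j x)) ?scaler0 //.
by apply: contra ne => /eqP <-; rewrite addrCA subrr addr0.
Qed.

Lemma hcomp_cyclic i j (Q : D) v : v \in piece j ->
  hcomp i (Q *: v) = wcomp (i - j) Q *: v.
Proof.
move=> hv; have [s us ->] := wcomp_sum Q.
rewrite scaler_suml !raddf_sum scaler_suml; apply: eq_bigr => n _ /=.
have hn := homog_comp n Q.
rewrite (hcomp_act _ _ hn); have [->|ne] := eqVneq n (i - j).
  by rewrite opprB addrCA subrr addr0 (hcomp_id hv) (wcomp_id (homog_comp _ Q)).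
rewrite (wcomp_ne hn ne) scale0r (hcomp_ne hv) ?scaler0 //.
by apply: contra ne => /eqP <-; rewrite opprB addrCA subrr addr0.
Qed.

Lemma cyclic_homog i j (Q : D) v : v \in piece j -> Q *: v \in piece i ->
  exists2 R, R \in homog (i - j) & Q *: v = R *: v.
Proof.
move=> hv hQ; exists (wcomp (i - j) Q); first exact: homog_comp.
by rewrite -(hcomp_cyclic i Q hv) hcomp_id.
Qed.

Lemma grsub_hcomp A i x : x \in A -> hcomp i x \in A.
Proof.
have [s us ex] := hcomp_sum x; rewrite {1}ex => hx.
have [si|si] := boolP (i \in s).
  by apply: (gr_comp us _ hx) si => j; exact: hcomp_piece.
rewrite ex hcompE ?(negPf si) ?rpred0 //.
by move=> j; exact: hcomp_piece.
Qed.

Lemma grsub_homog A B :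
    (forall i x, x \in piece i -> x \in A -> x \in B) -> grsub_le A B.
Proof.
move=> h x hx; have [s _ ->] := hcomp_sum x; apply: rpred_sum => i _.
by apply: h (hcomp_piece i x) _; exact: grsub_hcomp.
Qed.

Lemma hcomp_gr_comp (N : {pred M}) :
    (forall i x, x \in N -> hcomp i x \in N) ->
  forall (s : seq int) (f : int -> M), uniq s ->
    (forall i, f i \in piece i) -> \sum_(i <- s) f i \in N ->
  forall i, i \in s -> f i \in N.
Proof.
by move=> hN s f us hf hs i si; move/(hN i): hs; rewrite hcompE // si.
Qed.

Definition full_pred : {pred M} := predT.
Lemma full_submod : submod_closed full_pred. Proof. by []. Qed.
Lemma full_comp i x : x \in full_pred -> hcomp i x \in full_pred.
Proof. by []. Qed.
Definition grFull : grSub M := GrSub full_submod (hcomp_gr_comp full_comp).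

Section Sum.
Variables A B : grSub M.
Definition add_pred : {pred M} := fun x =>
  `[< exists a b, [/\ a \in A, b \in B & x = a + b] >].
Lemma add_predP x :
  reflect (exists a b, [/\ a \in A, b \in B & x = a + b]) (x \in add_pred).
Proof. exact: asboolP. Qed.
Lemma add_submod : submod_closed add_pred.
Proof.
split=> [|P x y]; first by apply/add_predP; exists 0, 0; rewrite !rpred0 addr0.
move=> /add_predP[a [b [ha hb ->]]] /add_predP[a' [b' [ha' hb' ->]]].
apply/add_predP; exists (P *: a + a'), (P *: b + b').
by rewrite scalerDr addrACA !rpredD ?rpredZ.
Qed.
Lemma add_comp i x : x \in add_pred -> hcomp i x \in add_pred.
Proof.
move=> /add_predP[a [b [ha hb ->]]]; apply/add_predP.
by exists (hcomp i a), (hcomp i b); rewrite raddfD !grsub_hcomp.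
Qed.
Definition grAdd : grSub M := GrSub add_submod (hcomp_gr_comp add_comp).

Lemma grAddP x :
  reflect (exists a b, [/\ a \in A, b \in B & x = a + b]) (x \in grAdd).
Proof. exact: asboolP. Qed.

Lemma grAddl x : x \in A -> x \in grAdd.
Proof. by move=> hx; apply/grAddP; exists x, 0; rewrite rpred0 addr0. Qed.
Lemma grAddr x : x \in B -> x \in grAdd.
Proof. by move=> hx; apply/grAddP; exists 0, x; rewrite rpred0 add0r. Qed.
Lemma grAdd_le (C : grSub M) : grsub_le A C -> grsub_le B C -> grsub_le grAdd C.
Proof.
move=> hAC hBC x /grAddP[a [b [ha hb ->]]].
by apply: rpredD; [exact: hAC | exact: hBC].
Qed.
End Sum.

Section Cyclic.
Variables (v : M) (hv : exists i, v \in piece i).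
Definition cyc_pred : {pred M} := fun x => `[< exists Q : D, x = Q *: v >].
Lemma cyc_submod : submod_closed cyc_pred.
Proof.
split=> [|P x y]; first by apply/asboolP; exists 0; rewrite scale0r.
move=> /asboolP[Q ->] /asboolP[Q' ->]; apply/asboolP.
by exists (P * Q + Q'); rewrite scalerDl scalerA.
Qed.
Lemma cyc_comp i x : x \in cyc_pred -> hcomp i x \in cyc_pred.
Proof.
have [j hj] := hv; move=> /asboolP[Q ->]; apply/asboolP.
by exists (wcomp (i - j) Q); rewrite (hcomp_cyclic _ _ hj).
Qed.
Definition grCyc : grSub M := GrSub cyc_submod (hcomp_gr_comp cyc_comp).

Lemma grCycP x : reflect (exists Q : D, x = Q *: v) (x \in grCyc).
Proof. exact: asboolP. Qed.

Lemma grCyc_gen : v \in grCyc.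
Proof. by apply/grCycP; exists 1; rewrite scale1r. Qed.

Lemma grCyc_le (A : grSub M) : v \in A -> grsub_le grCyc A.
Proof. by move=> vA x /grCycP[Q ->]; exact: rpredZ. Qed.
End Cyclic.

End HomogeneousComponents.

(** * Typed vectors and the submodules that they generate *)

Section GeneralizedEigenvectors.
Variable k : fieldType.
Variable M : grMod k.
Local Notation D := (weyl k).
Local Notation ofE := (horner_alg (wE k)).
Implicit Types (x y : M) (a b : k).

Definition geig a x : Prop := exists n, ofE (('X - a%:P) ^+ n) *: x = 0.

(** Coprimality with a power of ['X - a]: a polynomial in [E] not vanishing at
    the eigenvalue acts invertibly. *)
Lemma ofE_invertible a x f : geig a x -> ~~ root f a ->
  exists g, x = ofE (g * f) *: x.
Proof.
move=> [n hn] fa.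
have : coprimep f (('X - a%:P) ^+ n) by rewrite coprimep_expr ?coprimep_XsubC.
case/Bezout_eq1_coprimepP => -[u v] /= e; exists u.
rewrite -{1}[x]scale1r -(rmorph1 (horner_alg (wE k))) -e rmorphD scalerDl.
by rewrite [in X in _ + X]rmorphM /= -scalerA hn scaler0 addr0.
Qed.

Lemma geigB a x y : geig a x -> geig a y -> geig a (x - y).
Proof.
move=> [m hm] [n hn]; exists (m + n)%N; rewrite scalerBr.
have -> : ofE (('X - a%:P) ^+ (m + n)) *: x = 0.
  by rewrite addnC exprD rmorphM /= -scalerA hm scaler0.
by rewrite exprD rmorphM /= -scalerA hn scaler0 subr0.
Qed.

Lemma geig_act e (W : D) a x : W \in homog e -> geig a x ->
  geig (a + e%:~R) (W *: x).
Proof.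
move=> hW [n hn]; exists n; rewrite scalerA (homog_ofEr _ hW) -scalerA.
have -> : ('X - (a + e%:~R)%:P) ^+ n \Po ('X + e%:~R%:P) = ('X - a%:P) ^+ n.
  rewrite rmorphXn /= comp_polyB comp_polyX comp_polyC polyCD.
  by rewrite opprD addrA addrAC addrK.
by rewrite hn scaler0.
Qed.

Lemma geig_act0 f a x : geig a x -> geig a (ofE f *: x).
Proof. by move/(geig_act (ofE_homog0 f)); rewrite addr0. Qed.

Lemma geig_eq a b x : geig a x -> geig b x -> x != 0 -> a = b.
Proof.
move=> ha [n hn]; have [//|ne x0] := eqVneq a b.
have fa : ~~ root (('X - b%:P) ^+ n) a.
  by rewrite rootE horner_exp hornerXsubC expf_neq0 // subr_eq0.
have [g e] := ofE_invertible ha fa.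
by move: x0; rewrite e rmorphM /= -scalerA hn scaler0 eqxx.
Qed.

Lemma ofE_piece f i x : x \in piece i -> ofE f *: x \in piece i.
Proof. by move/(piece_act (ofE_homog0 f)); rewrite add0r. Qed.

End GeneralizedEigenvectors.

(** What the set indexing the modules [M(a, n)] is used for: up to an integer
    shift in a direction that no letter obstructs, it lists all the possible
    eigenvalues of [E] (through [ev]), each non-integral class once. *)
Record residue_system (k : fieldType) (I : set k) : Prop := ResidueSystem {
  res0 : I 0;
  res1 : I 1;
  res_adm : forall a, I a -> adm a;
  res_inj : forall a b, I a -> I b -> a \notin @kint k -> a - b \in @kint k ->
    a = b;
  res_ex : forall c, exists (a : k) (m : nat), I a /\
    ((a != 1 /\ c = ev a + m%:R) \/ (a != 0 /\ c = ev a - m%:R))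
}.

Section Typed.
Variable k : fieldType.
Hypothesis k_char0 : [pchar k] =i pred0.
Variables (I : set k) (I_res : residue_system I).
Variable M : grMod k.
Local Notation D := (weyl k).
Local Notation ofE := (horner_alg (wE k)).
Implicit Types (x y v : M) (a b : k) (A B : grSub M).

Definition typed a i x : Prop := [/\ I a, x \in piece i & geig (ev a) x].

Lemma I_nxt a : I a -> I (nxt a).
Proof.
move=> Ia; rewrite /nxt; case: eqP => _; first exact: res1 I_res.
by case: eqP => // _; exact: res0 I_res.
Qed.

Lemma typedB a i x y : typed a i x -> typed a i y -> typed a i (x - y).
Proof.
by move=> [Ia hx gx] [_ hy gy]; split; rewrite ?rpredB //; exact: geigB.
Qed.

Lemma typed_ofE a i x f : typed a i x -> typed a i (ofE f *: x).
Proof.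
by move=> [Ia hx gx]; split; rewrite ?ofE_piece //; exact: geig_act0.
Qed.

Lemma typed_deg a i x (W : D) : W \in homog (deg a) -> typed a i x ->
  typed (nxt a) (i + deg a) (W *: x).
Proof.
move=> hW [Ia hx gx]; split; first exact: I_nxt.
  by rewrite addrC piece_act.
by rewrite ev_nxt; exact: geig_act.
Qed.

Lemma typed_step a i x : typed a i x -> typed (nxt a) (i + deg a) (step a *: x).
Proof. exact/typed_deg/step_homog. Qed.

Lemma typed_Mgen a i x n : typed a i x ->
  exists j, typed (iter n (@nxt k) a) j (Mgen a n *: x).
Proof.
elim: n a i x => [|n IH] a i x hx; first by exists i; rewrite Mgen0 scale1r.
have [j hj] := IH _ _ _ (typed_step hx).
by exists j; rewrite Mgen_rec -scalerA iterSr.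
Qed.

(** Conversely to the nilpotency in modules of finite length, being killed by a
    word forces the eigenvalue, because [E - ev a] is a multiple of [step a]. *)
Lemma Mgen_typed a i x n : I a -> x \in piece i -> Mgen a n *: x = 0 ->
  typed a i x.
Proof.
elim: n a i x => [|n IH] a i x Ia hx.
  rewrite Mgen0 scale1r => ->; split; rewrite ?rpred0 //.
  by exists 0; rewrite scaler0.
rewrite Mgen_rec -scalerA => h.
have hs : step a *: x \in piece (i + deg a).
  by rewrite addrC piece_act ?step_homog.
have [_ _ [m hm]] := IH _ _ _ (I_nxt Ia) hs h.
split=> //; exists m.+1.
rewrite exprSr rmorphM /= ret_step -!scalerA scalerA.
have hr : ret a \in homog (- deg a).
  rewrite /ret /deg; case: eqP => _; first exact: homog_t.
  by case: eqP => _; [exact: homog_d | exact: homog1].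
rewrite (homog_ofEr _ hr) -scalerA rmorphXn /= comp_polyB comp_polyX comp_polyC.
have -> : 'X + (- deg a)%:~R%:P - (ev a)%:P = 'X - (ev (nxt a))%:P.
  by rewrite ev_nxt polyCD opprD addrA addrAC rmorphN polyCN.
by rewrite hm scaler0.
Qed.

(** A form of Nakayama's lemma.  In degree 0, [R * step a] is a multiple of
    [E - ev a], which is nilpotent on [y]; so [1 - R * step a] is invertible on
    [y] and recovers [y] from [u]. *)
Lemma nakayama a i y A u (R : D) : typed a i y -> u \in A ->
  y = u + R *: (step a *: y) -> y \in A.
Proof.
move=> [Ia hy gy] uA e.
have eh : y = hcomp i u + wcomp (- deg a) R *: (step a *: y).
  have hs : step a *: y \in piece (i + deg a).
    by rewrite addrC piece_act ?step_homog.
  rewrite -{1}(hcomp_id hy) {1}e raddfD /= (hcomp_cyclic _ _ hs).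
  by rewrite opprD addrA subrr add0r.
have [f ef] := homog_ret (homog_comp (- deg a) R).
pose h := 1 - f * ('X - (ev a)%:P).
have : ~~ root h (ev a).
  by rewrite rootE /h !hornerE subrr mulr0 subr0 oner_eq0.
case/(ofE_invertible gy) => g eg.
have hyu : ofE h *: y = hcomp i u.
  apply/eqP; rewrite rmorphB rmorph1 rmorphM /= ret_step scalerBl scale1r.
  by rewrite mulrA -ef -scalerA {1}eh addrK.
by rewrite eg rmorphM /= -scalerA hyu rpredZ ?grsub_hcomp.
Qed.

(** [step_maximal] makes [y] a multiple of [Q *: y] modulo [D (step a *: y)],
    and [nakayama] removes the error term. *)
Lemma typed_dichotomy a i m y A (Q : D) : typed a i y -> Q \in homog m ->
  Q *: y \in A -> y \in A \/ exists R, Q = R * step a.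
Proof.
move=> hy hQ hA; have [Ia _ _] := hy.
have [[R ->]|[R [S e]]] := step_maximal k_char0 (res_adm I_res Ia) hQ.
  by right; exists R.
left; apply: (@nakayama a i y A (R *: (Q *: y)) S) => //; first exact: rpredZ.
by rewrite !scalerA -scalerDl -[LHS]scale1r {1}e.
Qed.

Lemma typed_piece a i y : typed a i y -> exists j, y \in piece j.
Proof. by case=> _ hy _; exists i. Qed.

Lemma zero_piece : exists j, (0 : M) \in piece j.
Proof. by exists 0; exact: rpred0. Qed.

Lemma grCyc0 x : x \in grCyc zero_piece -> x = 0.
Proof. by case/grCycP => Q ->; rewrite scaler0. Qed.

Lemma Mgen_mono a x m n : (m <= n)%N -> Mgen a m *: x = 0 -> Mgen a n *: x = 0.
Proof. by move/subnK <-; rewrite Mgen_add -scalerA => ->; rewrite scaler0. Qed.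

(** By [typed_dichotomy] with the zero submodule, [Q] is a multiple of
    [step a]; the quotient kills [step a *: v], which is one step shorter. *)
Lemma annihilator_homog a i v n m (Q : D) : typed a i v ->
    (forall l, (l < n)%N -> Mgen a l *: v != 0) -> Mgen a n *: v = 0 ->
    Q \in homog m -> Q *: v = 0 -> exists R, Q = R * Mgen a n.
Proof.
elim: n a i v m Q => [|n IH] a i v m Q hv nz z hQ Qv.
  by exists Q; rewrite Mgen0 mulr1.
have Q0 : Q *: v \in grCyc zero_piece by rewrite Qv rpred0.
have [/grCyc0 v0|[R eR]] := typed_dichotomy hv hQ Q0.
  by have := nz 0%N isT; rewrite v0 scaler0 eqxx.
have eR' : Q = wcomp (m - deg a) R * step a.
  by rewrite -(wcompM _ _ (step_homog a)) -eR wcomp_id.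
rewrite Mgen_rec -scalerA in z.
have nz' l : (l < n)%N -> Mgen (nxt a) l *: (step a *: v) != 0.
  by move=> ln; rewrite scalerA -Mgen_rec nz.
rewrite eR' -scalerA in Qv.
have [S eS] := IH _ _ _ _ _ (typed_step hv) nz' z (homog_comp _ _) Qv.
by exists S; rewrite Mgen_rec mulrA -eS.
Qed.

Lemma annihilator a i v n (Q : D) : typed a i v ->
    (forall l, (l < n)%N -> Mgen a l *: v != 0) -> Mgen a n *: v = 0 ->
    Q *: v = 0 -> exists R, Q = R * Mgen a n.
Proof.
move=> hv nz z Qv; have [_ hp _] := hv; have [s _ ->] := wcomp_sum Q.
elim/big_ind: _ => [|x y [R ->] [R' ->]|m _].
- by exists 0; rewrite mul0r.
- by exists (R + R'); rewrite mulrDl.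
apply: (annihilator_homog hv nz z (homog_comp m Q)).
have := hcomp_cyclic (m + i) Q hp.
by rewrite addrK Qv raddf0.
Qed.

(** By [typed_dichotomy], a homogeneous multiple of [v] outside
    [D (step a *: v)] generates [v]. *)
Lemma proper_in_step a i v A (hv : exists j, v \in piece j)
    (hs : exists j, step a *: v \in piece j) :
  typed a i v -> v \notin A -> grsub_le A (grCyc hv) -> grsub_le A (grCyc hs).
Proof.
move=> tv nA lA; apply: grsub_homog => j x hx xA.
have /grCycP[Q eQ] := lA x xA; have [_ hp _] := tv.
move: (hx) (xA); rewrite eQ => /(cyclic_homog hp)[R hR ->] RA.
have [vA|[S ->]] := typed_dichotomy tv hR RA; first by rewrite vA in nA.
by apply/grCycP; exists S; rewrite scalerA.
Qed.

Lemma cyc_chain a i v n A B (hv : exists j, v \in piece j) :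
    typed a i v -> Mgen a n *: v = 0 ->
    grsub_le A (grCyc hv) -> grsub_le B (grCyc hv) ->
  grsub_le A B \/ grsub_le B A.
Proof.
elim: n a i v hv A B => [|n IH] a i v hv A B tv z lA lB.
  left=> x /lA /grCycP[Q ->]; move: z; rewrite Mgen0 scale1r => ->.
  by rewrite scaler0 rpred0.
have [vA|nA] := boolP (v \in A); first by right=> x /lB; exact: grCyc_le.
have [vB|nB] := boolP (v \in B); first by left=> x /lA; exact: grCyc_le.
have ts := typed_step tv; have hs := typed_piece ts.
apply: (IH (nxt a) (i + deg a) (step a *: v) hs A B ts).
- by rewrite scalerA -Mgen_rec.
- exact: proper_in_step tv nA lA.
- exact: proper_in_step tv nB lB.
Qed.

Lemma cyc_cover a i v (hv : exists j, v \in piece j)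
    (hs : exists j, step a *: v \in piece j) :
  typed a i v -> v != 0 -> grsub_cover (grCyc hs) (grCyc hv).
Proof.
move=> tv v0; split.
- by apply: grCyc_le; apply/grCycP; exists (step a).
- move/(_ v (grCyc_gen hv))/grCycP => [R eR]; case/eqP: v0.
  apply: grCyc0; apply: (nakayama (R := R) tv (rpred0 _)).
  by rewrite add0r.
- move=> C _ lC.
  have [vC|nC] := boolP (v \in C); first by right; apply: grCyc_le.
  by left; exact: proper_in_step tv nC lC.
Qed.

(** Two types reached from one another inside a cyclic module are equal or
    consecutive: the eigenvalues [ev] were chosen one for each non-integral
    class and the pair [0], [-1], joined by one letter, for the integral one. *)
Lemma typed_shift a i v b j l (Q : D) : typed a i v -> typed b j l ->
    l = Q *: v -> Q \in homog (j - i) -> l != 0 ->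
  (b = a /\ j = i) \/ [/\ b = nxt a, j = i + deg a & a = 0 \/ a = 1].
Proof.
move=> [Ia _ gv] [Ib _ gl] e hQ l0.
have := geig_act hQ gv; rewrite -e => /geig_eq/(_ gl l0).
move: (j - i) (subrK i j) => m <- eb.
have kE (n : int) : n%:~R \in @kint k by apply/asboolP; exists n.
have evE c : c \notin @kint k -> ev c = c.
  rewrite /ev; case: eqP => // -> /negP[]; exact: (kE 1).
have eb' (n : int) : ev a = n%:~R -> ev b = (n + m)%:~R.
  by move=> ea; rewrite -eb ea rmorphD.
have [a0|a1|na] := res_adm I_res Ia.
- have ea : ev a = 0%:~R by rewrite a0 /ev eq_sym oner_eq0.
  have := ev_int k_char0 (res_adm I_res Ib) (eb' _ ea).
  rewrite add0r => -[[b0 m0]|[b1 m1]]; first by left; rewrite a0 b0 m0 add0r.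
  right; split; last by left.
    by rewrite b1 a0 /nxt eqxx.
  by rewrite m1 a0 /deg eqxx addrC.
- have ea : ev a = (-1)%:~R by rewrite a1 /ev eqxx rmorphN1.
  have := ev_int k_char0 (res_adm I_res Ib) (eb' _ ea).
  case=> [[b0 m0]|[b1 m1]].
    right; split; last by right.
      by rewrite b0 a1 /nxt oner_eq0 eqxx.
    have -> : m = 1 by apply: (addrI (-1)); rewrite m0 addNr.
    by rewrite a1 /deg oner_eq0 eqxx addrC.
  left; split; first by rewrite a1.
  have -> : m = 0 by apply: (addrI (-1)); rewrite m1 addr0.
  by rewrite add0r.
rewrite (evE a na) in eb.
have nb : b \notin @kint k.
  apply: contra na => hb; rewrite -[a](addrK m%:~R) eb rpredB ?kE // /ev.
  by case: eqP => // _; exact: (kE (-1)).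
rewrite (evE b nb) in eb.
have ab : a = b.
  apply: (res_inj I_res) => //.
  by rewrite -eb opprD addrA subrr add0r -rmorphN kE.
left; split=> //; have -> : m = 0.
  apply: (intr_inj_char0 k_char0); apply: (addrI a); by rewrite eb addr0.
by rewrite add0r.
Qed.

Lemma Mgen_homog_ofE a n f : exists g, Mgen a n * ofE f = ofE g * Mgen a n.
Proof. by have [e he] := Mgen_homog a n; eexists; exact: homog_ofE he. Qed.

(** Write [l] as a combination of the paths from [v]: the constant path does not
    occur, since it would give [l] the full length of [v], and every other path
    into [nxt b] ends with the arrow [step b]. *)
Lemma cyc_divisible a i v n b j l (hv : exists j, v \in piece j) :
    typed a i v -> Mgen a n.+1 *: v = 0 -> Mgen a n *: v != 0 -> I b ->
    typed (nxt b) (j + deg b) l -> l \in grCyc hv -> Mgen (nxt b) n *: l = 0 ->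
  exists y, [/\ typed b j y, y \in grCyc hv & step b *: y = l].
Proof.
move=> tv z nz Ib tl /grCycP[Q0 e0] zl.
have [->|l0] := eqVneq l 0.
  exists 0; split; rewrite ?rpred0 ?scaler0 //; split; rewrite ?rpred0 //.
  by exists 0%N; rewrite scaler0.
have [_ hp _] := tv; have [_ hl _] := tl.
move: (hl); rewrite {1}e0 => /(cyclic_homog hp)[Q hQ eQ]; rewrite {}eQ in e0.
have [[eb ej]|[eb ej ha]] := typed_shift tv tl e0 hQ l0.
  rewrite ej subrr in hQ; have [f ef] := homog_zero hQ.
  have ebn : b = nxt a by rewrite -eb nxtK.
  have : root (f - (f.[ev a])%:P) (ev a) by rewrite rootE !hornerE subrr.
  case/factor_theorem => g eg.
  have ef' : f = (f.[ev a])%:P + g * ('X - (ev a)%:P).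
    by rewrite -eg addrCA subrr addr0.
  (* [f.[ev a]] is the coefficient of the constant path. *)
  have f0 : f.[ev a] = 0.
    apply/eqP; apply: contraNT nz => c0.
    have zz : Mgen a n *: (ofE ('X - (ev a)%:P) *: v) = 0.
      rewrite ret_step -scalerA.
      have [|a0] := boolP ((a == 0) || (a == 1)).
        move=> a01; have -> : ret a = step (nxt a).
          by case/orP: a01 => /eqP ->;
            rewrite /ret /step /nxt ?eqxx ?oner_eq0 ?eqxx ?oner_eq0 ?eqxx.
        rewrite !scalerA.
        have -> : Mgen a n * (step (nxt a) * step a) = Mgen a n.+2.
          by rewrite !Mgen_rec nxtK mulrA.
        exact: Mgen_mono z.
      have -> : ret a = 1.
        by move: a0; rewrite /ret; case: eqP => //= _; case: eqP.
      have na : nxt a = a.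
        by move: a0; rewrite /nxt; case: eqP => //= _; case: eqP.
      by rewrite scale1r scalerA -{1}na -Mgen_rec.
    have [g' eg'] := Mgen_homog_ofE a n g.
    move: zl; rewrite eb e0 ef ef' rmorphD rmorphM /= horner_algC scalerDl.
    rewrite scalerDr -[(ofE g * _) *: v]scalerA.
    rewrite [X in _ + X]scalerA eg' -[X in _ + X]scalerA zz scaler0 addr0.
    rewrite scalerA mulr_algr => h.
    have : (f.[ev a])^-1%:A *: ((f.[ev a] *: Mgen a n) *: v) = 0.
      by rewrite h scaler0.
    by rewrite scalerA mulr_algl scalerA mulVf // scale1r => ->.
  exists (cor a *: (ofE g *: v)); split.
  - have -> : j = i + deg a.
      have := ej; rewrite ebn /deg /nxt => <-.
      have [_|a0] := eqVneq a 0; first by rewrite oner_eq0 eqxx addrK.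
      have [_|a1] := eqVneq a 1; first by rewrite eqxx subrK.
      by rewrite (negPf a0) (negPf a1) !addr0.
    by rewrite ebn; apply: (typed_deg (cor_homog a)); exact: typed_ofE.
  - by apply/grCycP; exists (cor a * ofE g); rewrite scalerA.
  - rewrite e0 ef ef' f0 polyC0 add0r mulrC rmorphM /= step_cor ebn.
    by rewrite !scalerA.
have ba : b = a by rewrite -[b]nxtK eb nxtK.
subst b.
have eji : j = i by apply: (addIr (deg a)).
have hQ' : Q \in homog (deg a) by rewrite ej addrC addrA addNr add0r in hQ.
have [g eg] : exists g, Q = step a * ofE g.
  case: ha hQ' => ->; rewrite /deg /step ?eqxx ?oner_eq0 ?eqxx.
    case/(@homog_neg _ 1) => f ->; rewrite expr1.
    by eexists; exact: homog_ofEr (homog_d k).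
  case/(@homog_pos _ 1) => f ->; rewrite expr1.
  by eexists; exact: homog_ofEr (homog_t k).
exists (ofE g *: v); split.
- by rewrite eji; exact: typed_ofE.
- by apply/grCycP; exists (ofE g).
- by rewrite scalerA -eg.
Qed.

(** The graded submodules isomorphic to [M(a, n)], characterized inside the
    ambient module. *)
Definition standard A a n : Prop :=
  exists i v (hv : exists j, v \in piece j),
  [/\ typed a i v, (0 < n)%N, Mgen a n *: v = 0,
      forall l, (l < n)%N -> Mgen a l *: v != 0 & A = grCyc hv].

End Typed.

(** * Modules of finite length *)

Section FiniteLength.
Variable k : closedFieldType.
Hypothesis k_char0 : [pchar k] =i pred0.
Variables (I : set k) (I_res : residue_system I).
Variable M : grMod k.
Local Notation D := (weyl k).
Local Notation t := (wt k).
Local Notation d := (wd k).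
Local Notation ofE := (horner_alg (wE k)).
Implicit Types (x y v : M) (a b c : k) (A B C K : grSub M).

Section Generation.
Hypothesis loc_fin : forall i x, x \in piece i ->
  exists2 f : {poly k}, f != 0 & ofE f *: x = 0.
Variables A B : grSub M.
Hypothesis typed_AB : forall a i x, typed I a i x -> x \in B -> x \in A.

(** Away from the resonant eigenvalues [t d] and [d t] are invertible on
    generalized eigenvectors, so a vector can be moved to one whose eigenvalue
    is of the form [ev a] without losing the submodule it generates. *)
Lemma geig_generation c i x : x \in piece i -> geig c x -> x \in B -> x \in A.
Proof.
have [a [m [Ia h]]] := res_ex I_res c; have ha := res_adm I_res Ia.
case: h => -[a1 ->]; elim: m i x => [|m IH] i x hx gx xB.
- by apply: typed_AB xB; split; [exact: Ia | exact: hx | rewrite addr0 in gx].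
- have dA : d *: x \in A.
    apply: (IH _ _ (piece_act (homog_d k) hx)); last exact: rpredZ.
    have := geig_act (homog_d k) gx.
    by rewrite rmorphN1 -natr1 addrA addrK.
  have r : ~~ root 'X (ev a + m.+1%:R).
    rewrite rootX; apply/eqP => e.
    have : ev a = (- (m.+1)%:Z)%:~R.
      by apply/eqP; rewrite -subr_eq0 rmorphN opprK e.
    by case/(ev_int k_char0 ha) => -[ae] //; rewrite ae eqxx in a1.
  have [g ->] := ofE_invertible gx r.
  by rewrite rmorphM /= horner_algX {2}/wE -!scalerA; do 2!apply: rpredZ.
- by apply: typed_AB xB; split; [exact: Ia | exact: hx | rewrite subr0 in gx].
- have tA : t *: x \in A.
    apply: (IH _ _ (piece_act (homog_t k) hx)); last exact: rpredZ.
    have := geig_act (homog_t k) gx.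
    by rewrite -natr1 opprD addrA subrK.
  have r : ~~ root ('X + 1) (ev a - m.+1%:R).
    rewrite rootE !hornerE -natr1 opprD addrA subrK; apply/eqP => e.
    have : ev a = (m%:Z)%:~R by apply/eqP; rewrite -subr_eq0 e.
    by case/(ev_int k_char0 ha) => -[ae] //; rewrite ae eqxx in a1.
  have [g ->] := ofE_invertible gx r.
  have e : ofE ('X + 1) = d * t by rewrite rmorphD rmorph1 /= horner_algX wdt.
  by rewrite rmorphM /= e -!scalerA; do 2!apply: rpredZ.
Qed.

(** A homogeneous vector killed by a polynomial in [E] is the sum of its
    generalized eigencomponents, which are obtained by splitting off one root at
    a time. *)
Lemma typed_generation : grsub_le B A.
Proof.
apply: grsub_homog => i x hx.
have [f f0 fx] := loc_fin hx.
move: {2}(size f) (leqnn (size f)) => s.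
elim: s f f0 x hx fx => [|s IH] f f0 x hx fx fs xB.
  by rewrite leqn0 size_poly_eq0 (negPf f0) in fs.
have [sf|/closed_rootP[c rc]] := eqVneq (size f) 1%N.
  have /size_poly1P[e e0 ef] : size f == 1%N by rewrite sf.
  have -> : x = 0; last exact: rpred0.
  have := congr1 (fun y => (e^-1%:A : D) *: y) fx.
  rewrite ef /= horner_algC scaler0 scalerA mulr_algl scalerA mulVf //.
  by rewrite !scale1r.
have [m [q rq ef]] := multiplicity_XsubC f c.
rewrite f0 /= in rq.
have m0 : (0 < m)%N.
  by rewrite lt0n; apply: contraNneq rq => m0; rewrite ef m0 mulr1 in rc.
have cop : coprimep q (('X - c%:P) ^+ m).
  by rewrite coprimep_expr ?coprimep_XsubC.
have [[u v] /= e] := Bezout_eq1_coprimepP _ _ cop.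
rewrite -[x]scale1r -(rmorph1 (horner_alg (wE k))) -e rmorphD scalerDl.
apply: rpredD.
  apply: (@geig_generation c i); rewrite ?ofE_piece ?rpredZ //.
  exists m; rewrite scalerA -rmorphM mulrCA [_ * q]mulrC -ef.
  by rewrite rmorphM -scalerA fx scaler0.
have q0 : q != 0 by apply: contraNneq f0 => q0; rewrite ef q0 mul0r.
apply: (IH q); rewrite ?ofE_piece ?rpredZ //.
  by rewrite scalerA -rmorphM mulrCA -ef rmorphM -scalerA fx scaler0.
move: fs; rewrite ef size_Mmonic ?monic_exp ?monicXsubC // size_exp_XsubC.
rewrite addnS /= => h; rewrite -ltnS; apply: leq_trans h.
by rewrite -[X in (X < _)%N]addn0 ltn_add2l.
Qed.

End Generation.

Variables (len : nat) (N : nat -> grSub M).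
Hypothesis N0 : gr_mem (N 0%N) =i pred1 0.
Hypothesis Nlen : gr_mem (N len) =i predT.
Hypothesis Ncover : forall j, (j < len)%N -> grsub_cover (N j) (N j.+1).

(** On a simple graded subquotient [x] is a multiple of [E *: x] unless the
    latter vanishes; in degree 0 this is a polynomial relation for [E]. *)
Lemma finite_length_loc_fin i x : x \in piece i ->
  exists2 f : {poly k}, f != 0 & ofE f *: x = 0.
Proof.
suff main j : (j <= len)%N -> forall y, y \in piece i -> y \in N j ->
    exists2 f : {poly k}, f != 0 & ofE f *: y = 0.
  by move=> hx; apply: (main len) => //; rewrite Nlen.
elim: j => [_ y hy|j IH lj y hy yN].
  by rewrite N0 => /eqP ->; exists 1; rewrite ?oner_neq0 ?scaler0.
suff [f f0 fN] : exists2 f : {poly k}, f != 0 & ofE f *: y \in N j.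
  have [g g0 gf] := IH (ltnW lj) _ (ofE_piece f hy) fN.
  by exists (g * f); rewrite ?mulf_neq0 // rmorphM -scalerA.
have hEy : ofE 'X *: y \in piece i by exact: ofE_piece.
have hE : exists l, ofE 'X *: y \in piece l by exists i.
have [lN nN maxN] := Ncover lj.
have Ny : ofE 'X *: y \in N j.+1 by exact: rpredZ.
case: (maxN (grAdd (N j) (grCyc hE))) => [|||h].
- exact: grAddl.
- by apply: grAdd_le => //; exact: grCyc_le.
- by move=> h; exists 'X; rewrite ?polyX_eq0 // h // grAddr ?grCyc_gen.
have /grAddP[u [w [uN /grCycP[Q ->] e]]] := h y yN.
have [q eq] := homog_zero (homog_comp 0 Q).
exists (1 - q * 'X).
  apply: contraTneq (oner_neq0 k) => /(congr1 (fun p => p.[0])).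
  by rewrite /= !hornerE ?mulr0 ?subr0 => ->; rewrite eqxx.
rewrite rmorphB rmorph1 rmorphM scalerBl scale1r -{1}(hcomp_id hy) {1}e.
rewrite raddfD /=.
rewrite (hcomp_cyclic _ _ hEy) subrr eq scalerA addrK.
exact: grsub_hcomp.
Qed.

(** On a simple subquotient [step a] kills typed vectors, by [nakayama]. *)
Lemma typed_step_filtration a i x j : (j < len)%N -> typed I a i x ->
  x \in N j.+1 -> step a *: x \in N j.
Proof.
move=> lj tx xN; have hs := typed_piece (typed_step I_res tx).
have [lN nN maxN] := Ncover lj.
case: (maxN (grAdd (N j) (grCyc hs))) => [|||h].
- exact: grAddl.
- by apply: grAdd_le => //; apply: grCyc_le; exact: rpredZ.
- by move=> h; rewrite h // grAddr ?grCyc_gen.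
have /grAddP[u [w [uN /grCycP[Q ->] e]]] := h x xN.
by apply: rpredZ; exact: (nakayama tx uN e).
Qed.

Lemma typed_nilpotent a i x : typed I a i x -> Mgen a len *: x = 0.
Proof.
suff main j : (j <= len)%N -> forall a i x, typed I a i x -> x \in N j ->
    Mgen a j *: x = 0.
  by move=> tx; apply: (main len _ _ i); rewrite ?Nlen.
elim: j => [_ b l y ty|j IH lj b l y ty yN].
  by rewrite N0 => /eqP ->; rewrite scaler0.
rewrite Mgen_rec -scalerA; apply: IH (ltnW lj) _ _ _ (typed_step I_res ty) _.
exact: typed_step_filtration lj ty yN.
Qed.

(** The number of steps of the composition series to which [A] contributes:
    a length of [A] that needs no comparison of composition series. *)
Definition glen A : nat :=
  \sum_(j < len) `[< exists x, [/\ x \in A, x \in N j.+1 & x \notin N j] >].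

Lemma glen_max A : (glen A <= len)%N.
Proof.
rewrite -[X in (_ <= X)%N]card_ord -sum1_card; apply: leq_sum => j _.
exact: leq_b1.
Qed.

Lemma glen_step A B (j : nat) : grsub_le A B ->
  (`[< exists x, [/\ x \in A, x \in N j.+1 & x \notin N j] >] <=
   `[< exists x, [/\ x \in B, x \in N j.+1 & x \notin N j] >])%N.
Proof.
move=> AB; case: asboolP => // -[x [xA xN nx]].
by have -> : `[< exists x, [/\ x \in B, x \in N j.+1 & x \notin N j] >];
  [apply/asboolP; exists x; split => //; exact: AB|].
Qed.

(** If [B] contributes to no more steps than [A], each element of [B] is
    corrected by elements of [A] down the composition series until it is 0. *)
Lemma glen_strict A B : grsub_le A B -> (glen B <= glen A)%N -> grsub_le B A.
Proof.
move=> AB le.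
have same (j : 'I_len) :
    `[< exists x, [/\ x \in A, x \in N j.+1 & x \notin N j] >] =
    `[< exists x, [/\ x \in B, x \in N j.+1 & x \notin N j] >].
  move: le; rewrite leqNgt; apply: contraNeq => ne.
  rewrite /glen (bigD1 j) //= [X in (_ < X)%N](bigD1 j) //=.
  rewrite -addSn leq_add //; last by apply: leq_sum => l _; exact: glen_step.
  have := glen_step j AB; move: ne.
  by case: `[< exists x, [/\ x \in A, _ & _] >]; case: `[< _ >].
suff main j : (j <= len)%N -> forall x, x \in B -> x \in N j -> x \in A.
  by move=> x xB; apply: (main len) => //; rewrite Nlen.
elim: j => [_ x _|j IH lj x xB xN].
  by rewrite N0 => /eqP ->; exact: rpred0.
have [xj|nj] := boolP (x \in N j); first exact: IH (ltnW lj) _ xB xj.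
have : `[< exists x, [/\ x \in B, x \in N j.+1 & x \notin N j] >].
  by apply/asboolP; exists x.
rewrite -(same (Ordinal lj)) => /asboolP[y [yA yN ny]].
have [hy|hy] := boolP (y \in N j); first by rewrite hy in ny.
have [lN nN maxN] := Ncover lj.
have hI : submod_closed (fun z => (z \in A) && (z \in N j.+1)).
  split=> [|P z w]; first by rewrite -topredE /= !rpred0.
  rewrite -!topredE /= => /andP[z1 z2] /andP[w1 w2].
  by rewrite !rpredD ?rpredZ.
have hc i z : z \in (fun z => (z \in A) && (z \in N j.+1)) ->
    hcomp i z \in (fun z => (z \in A) && (z \in N j.+1)).
  by rewrite -!topredE /= => /andP[z1 z2]; rewrite !grsub_hcomp.
pose AN : grSub M := GrSub hI (hcomp_gr_comp hc).
case: (maxN (grAdd (N j) AN)) => [|||h].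
- exact: grAddl.
- by apply: grAdd_le => // z; rewrite -topredE /= => /andP[].
- move=> h; case/negP: ny; apply: h; apply: grAddr.
  by rewrite -topredE /= yA yN.
have /grAddP[u [w [uN wA e]]] := h x xN.
move: wA; rewrite -topredE /= => /andP[wA _].
rewrite e rpredD //; apply: (IH (ltnW lj)) => //.
have -> : u = x - w by rewrite e addrK.
by rewrite rpredB //; exact: AB.
Qed.

Lemma max_grsub (P : grSub M -> Prop) A : P A ->
  exists2 K, P K & forall C, P C -> grsub_le K C -> grsub_le C K.
Proof.
move=> PA; pose p m := `[< exists2 K, P K & glen K = m >].
have ex : exists m, p m by exists (glen A); apply/asboolP; exists A.
have ub m : p m -> (m <= len)%N by case/asboolP => K _ <-; exact: glen_max.
case: (ex_maxnP ex ub) => m /asboolP[K PK <-] hmax.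
exists K => // C PC KC; apply: glen_strict => //.
by apply: hmax; apply/asboolP; exists C.
Qed.

(** A typed vector [v] of maximal length generates a direct summand.  A maximal
    [K] that meets [D v] trivially is a complement: a typed [x] outside
    [K + D v] may be chosen with [step b *: x] inside; by maximality of the
    length of [v] the [D v]-part of [step b *: x] is divisible by [step b], and
    subtracting the quotient from [x] gives a vector that enlarges [K]. *)
Lemma cyclic_summand B : (exists2 x, x \in B & x != 0) ->
  exists a i v n (hv : exists j, v \in piece j) K,
  [/\ typed I a i v /\ v \in B, Mgen a n.+1 *: v = 0, Mgen a n *: v != 0,
      grsub_le K B /\ forall x, x \in K -> x \in grCyc hv -> x = 0
    & grsub_le B (grAdd (grCyc hv) K)].
Proof.
move=> [x0 x0B x0n].
pose p m := `[< exists a i v,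
  [/\ typed I a i v, v \in B & Mgen a m *: v != 0] >].
have ex : exists m, p m.
  exists 0%N; apply/asboolP; apply: contrapT => none; case/eqP: x0n.
  apply: grCyc0; apply: (typed_generation finite_length_loc_fin _ x0B).
  move=> a i x tx xB; have [->|xn] := eqVneq x 0; first exact: rpred0.
  by case: none; exists a, i, x; rewrite Mgen0 scale1r.
have ub m : p m -> (m <= len)%N.
  case/asboolP => a [i [v [tv _ nz]]]; rewrite leqNgt; apply: contra nz => lm.
  by rewrite (Mgen_mono (ltnW lm) (typed_nilpotent tv)).
case: (ex_maxnP ex ub) => n /asboolP[a [i [v [tv vB nz]]]] hmax.
have zmax b j x : typed I b j x -> x \in B -> Mgen b n.+1 *: x = 0.
  move=> tx xB; apply/eqP; apply: contraT => nx.
  by have := hmax n.+1; rewrite ltnn => -> //; apply/asboolP; exists b, j, x.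
have hv := typed_piece tv; set L := grCyc hv.
have LB : grsub_le L B by exact: grCyc_le.
have [|K [KB KL] Kmax] := @max_grsub (fun K => grsub_le K B /\
    forall x, x \in K -> x \in L -> x = 0) (grCyc (zero_piece M)).
  by split=> [|x /grCyc0 //]; apply: grCyc_le; exact: rpred0.
exists a, i, v, n, hv, K; split => //; first exact: zmax tv vB.
have LK0 (P : D) l u : l \in L -> u \in K -> P *: (l + u) = 0 -> P *: l = 0.
  move=> lL uK; rewrite scalerDr => /eqP; rewrite addr_eq0 => /eqP e.
  by apply: KL; [rewrite e rpredN rpredZ | rewrite rpredZ].
apply: (typed_generation finite_length_loc_fin).
suff lift b j x : typed I b j x -> x \in B -> step b *: x \in grAdd L K ->
    x \in grAdd L K.
  have down m : forall b j x, typed I b j x -> x \in B ->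
      Mgen b m *: x \in grAdd L K -> x \in grAdd L K.
    elim: m => [|m IH] b j x tx xB; first by rewrite Mgen0 scale1r.
    rewrite Mgen_rec -scalerA => h; apply: (lift b j) => //.
    by apply: IH (typed_step I_res tx) _ h; exact: rpredZ.
  move=> b j x tx xB; apply: (down n.+1 b j x tx xB).
  by rewrite (zmax _ _ _ tx xB) rpred0.
move=> tx xB /grAddP[l0 [u0 [l0L u0K e0]]].
have [Ib hx gx] := tx; have [_ hs [m gs]] := typed_step I_res tx.
pose l := hcomp (j + deg b) l0; pose u := hcomp (j + deg b) u0.
have lL : l \in L by exact: grsub_hcomp.
have uK : u \in K by exact: grsub_hcomp.
have e : step b *: x = l + u by rewrite -raddfD -e0 /= hcomp_id.
have tl : typed I (nxt b) (j + deg b) l.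
  split; [exact: I_nxt | exact: hcomp_piece|].
  by exists m; apply: LK0 lL uK _; rewrite -e.
have zl : Mgen (nxt b) n *: l = 0.
  by apply: LK0 lL uK _; rewrite -e scalerA -Mgen_rec (zmax _ _ _ tx xB).
have [y [ty yL ey]] :=
  cyc_divisible k_char0 I_res tv (zmax _ _ _ tv vB) nz Ib tl lL zl.
pose x' := x - y; have tx' : typed I b j x' by exact: typedB.
have sx' : step b *: x' = u by rewrite scalerBr e ey addrAC subrr add0r.
have hx' := typed_piece tx'.
have xx' : x = y + x' by rewrite addrCA subrr addr0.
suff : x' \in grAdd L K by move=> h; rewrite xx' rpredD // grAddl.
have x'B : x' \in B by rewrite rpredB // LB.
have [disj|] :=
  pselect (forall z, z \in grAdd K (grCyc hx') -> z \in L -> z = 0).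
  apply: grAddr; apply: (Kmax (grAdd K (grCyc hx'))).
  - by split=> //; apply: grAdd_le => //; exact: grCyc_le.
  - exact: grAddl.
  - by apply: grAddr; exact: grCyc_gen.
move=> nd; apply: contrapT => nx'; apply: nd => z zK zL.
have [s _ ->] := hcomp_sum z; apply: big1 => r _.
have /grAddP[w [q [wK /grCycP[Q eq] ez]]] := zK.
have [_ px' _] := tx'.
have er : hcomp r z = hcomp r w + wcomp (r - j) Q *: x'.
  by rewrite ez raddfD /= eq (hcomp_cyclic _ _ px').
apply: KL; last exact: grsub_hcomp.
rewrite er; apply: rpredD; first exact: grsub_hcomp.
have QA : wcomp (r - j) Q *: x' \in grAdd L K.
  have -> : wcomp (r - j) Q *: x' = hcomp r z - hcomp r w.
    by rewrite er addrAC subrr add0r.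
  by apply: rpredB; [apply: grAddl | apply: grAddr]; exact: grsub_hcomp.
have [//|[R ->]] := typed_dichotomy k_char0 I_res tx' (homog_comp _ Q) QA.
by rewrite -scalerA sx' rpredZ.
Qed.

(** The families are indexed by [nat] and restricted to [j < r], so that adding
    a summand is a shift of indices. *)
Lemma decomposition B :
  exists r (S : nat -> grSub M) (a : nat -> k) (n : nat -> nat),
  [/\ forall j, (j < r)%N -> standard I (S j) (a j) (n j),
      forall j, (j < r)%N -> grsub_le (S j) B,
      forall x, x \in B -> exists2 f : nat -> M,
        forall j, (j < r)%N -> f j \in S j & x = \sum_(j < r) f j
    & forall f : nat -> M, (forall j, (j < r)%N -> f j \in S j) ->
        \sum_(j < r) f j = 0 -> forall j, (j < r)%N -> f j = 0].
Proof.
have [s] := ubnP (glen B); elim: s B => // s IH B; rewrite ltnS => hs.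
have [[x xB x0]|none] := pselect (exists2 x, x \in B & x != 0); last first.
  exists 0%N, (fun=> B), (fun=> 0), (fun=> 0%N); split=> // x xB.
  exists (fun=> 0) => //.
  by rewrite big_ord0; apply/eqP; apply: contraT => x0; case: none; exists x.
have [|a [i [v [n [hv [K [[tv vB] z nz [KB KL] hB]]]]]]] :=
  @cyclic_summand B; first by exists x.
have LB : grsub_le (grCyc hv) B by exact: grCyc_le.
have ltK : (glen K < glen B)%N.
  rewrite ltnNge; apply: contra nz => /(glen_strict KB)/(_ v vB) vK.
  by rewrite (KL v vK (grCyc_gen hv)) scaler0.
have [|r [S [al [nn [std sB gen ind]]]]] := IH K; first exact: leq_trans ltK hs.
exists r.+1, (fun j => if j is j'.+1 then S j' else grCyc hv),
  (fun j => if j is j'.+1 then al j' else a),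
  (fun j => if j is j'.+1 then nn j' else n.+1).
split.
- case=> [_|j /std //]; exists i, v, hv; split => // l; rewrite ltnS => ln.
  by apply: contraNneq nz => zl; rewrite (Mgen_mono ln zl).
- by case=> [_ //|j jr y yS]; apply: KB; exact: sB yS.
- move=> y /hB/grAddP[l [u [lL uK ->]]]; have [f hf ->] := gen u uK.
  exists (fun j => if j is j'.+1 then f j' else l); first by case.
  by rewrite big_ord_recl.
- move=> f hf; rewrite big_ord_recl /= => e.
  have SK : \sum_(j < r) f j.+1 \in K.
    apply: rpred_sum => j _; apply: (sB j) => //.
    exact: (hf j.+1 (ltn_ord j)).
  have f0 : f 0%N = 0.
    apply: KL; last exact: (hf 0%N).
    by move/eqP: e; rewrite addr_eq0 => /eqP ->; rewrite rpredN.
  rewrite f0 add0r in e.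
  case=> // j jr; apply: (ind (fun j => f j.+1)) => // l lr.
  exact: (hf l.+1).
Qed.

End FiniteLength.

(** * The Weyl algebra is a domain *)

Section WeylDomain.
Variable k : fieldType.
Local Notation D := (weyl k).
Local Notation t := (wt k).
Local Notation E := (wE k).

Lemma lead_wder (Q : {poly {poly k}}) i : Q != 0 ->
  size (iter i (@wder k) Q) = (size Q + i)%N /\
  lead_coef (iter i (@wder k) Q) = lead_coef Q.
Proof.
move=> Q0; elim: i => [|i [IHs IHl]]; first by rewrite addn0.
rewrite /= {1 3}/wder; set P := iter i _ _ in IHs IHl *.
have P0 : P != 0 by rewrite -size_poly_gt0 IHs addn_gt0 size_poly_gt0 Q0.
have lt : (size (map_poly (@deriv k) P) < size ('X * P)%R)%N.
  by rewrite mulrC size_mulX // ltnS size_poly.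
rewrite size_polyDl // lead_coefDl // mulrC size_mulX // lead_coefMX IHs addnS.
by rewrite IHl.
Qed.

(** The leading coefficient in [d] is multiplicative, as for commuting
    variables; in particular [D] is a domain. *)
Lemma lead_weylM (P Q : D) : Q != 0 ->
  (P * Q : {poly {poly k}})`_((size (P : {poly {poly k}})).-1
     + (size (Q : {poly {poly k}})).-1)
    = lead_coef (P : {poly {poly k}}) * lead_coef (Q : {poly {poly k}}).
Proof.
move=> Q0; rewrite {1}/GRing.mul /= /wmul.
have [->|P0] := eqVneq P 0.
  by rewrite lead_coef0 mul0r size_poly0 big_ord0 coef0.
set p := size (P : {poly {poly k}}).
have p0 : (0 < p)%N by rewrite size_poly_gt0.
have sQ : (0 < size (Q : {poly {poly k}}))%N by rewrite size_poly_gt0.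
have lp : (p.-1 < p)%N by rewrite prednK.
rewrite coef_sum (bigD1 (Ordinal lp)) //= big1 ?addr0 => [|i ne].
  have [s l] := lead_wder p.-1 Q0; rewrite coefZ; congr (_ * _).
  by rewrite -l lead_coefE s -(prednK sQ) addSn addnC.
rewrite coefZ [X in _ * X]nth_default ?mulr0 //; have [-> _] := lead_wder i Q0.
have ip : (i < p.-1)%N.
  by rewrite ltn_neqAle -ltnS prednK // ltn_ord andbT; exact: ne.
by rewrite -[X in (X + i)%N]prednK // addSn addnC ltn_add2r.
Qed.

Lemma weyl_mul_eq0 (P Q : D) : P * Q = 0 -> Q != 0 -> P = 0.
Proof.
move=> e Q0; have := lead_weylM P Q0; rewrite e coef0 => /esym/eqP.
by rewrite mulf_eq0 !lead_coef_eq0 (negPf Q0) orbF => /eqP.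
Qed.

Lemma wcoef_Euler a : wcoef (E - a%:A) 1 1 != 0.
Proof.
rewrite wcoefB wcoefZ /wE -[t]expr1 -[wd k]expr1 wtMd /wcoef coefZ !coefXn.
by rewrite mulr1 coefXn coef1 coef0 mulr0 subr0 oner_neq0.
Qed.

(** Comparing leading coefficients in [d]: each [step] has positive order in [d]
    except [t], for which the comparison happens in [k[t]]. *)
Lemma step_not_invertible a (R : D) : 1 <> R * step a.
Proof.
move=> e; have s0 : step a != 0.
  by apply: contraNneq (oner_neq0 D) => s0; rewrite e s0 mulr0.
have R0 : R != 0 by apply: contraNneq (oner_neq0 D) => R0; rewrite e R0 mul0r.
have := lead_weylM R s0; rewrite -e.
have [a1|a1] := eqVneq a 1.
  have -> : step a = t by rewrite /step a1 oner_eq0 eqxx.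
  rewrite size_polyC polyX_eq0 addn0 lead_coefC coef1.
  case: eqP => _; last first.
    by move/esym/eqP; rewrite mulf_eq0 polyX_eq0 orbF lead_coef_eq0 (negPf R0).
  by move/(congr1 (fun p : {poly k} => p.[0]))/eqP;
    rewrite /= !hornerE ?mulr0 oner_eq0.
have [i c1] : exists i, wcoef (step a) i 1 != 0.
  rewrite /step (negPf a1); case: eqP => _.
    by exists 0%N; rewrite /wcoef coefX coef1 oner_neq0.
  by exists 1%N; rewrite wcoef_Euler.
have s1 : (1 < size (step a : {poly {poly k}}))%N.
  rewrite ltnNge; apply: contra c1 => /leq_sizeP/(_ 1%N (leqnn 1)) s1.
  by rewrite /wcoef s1 coef0.
rewrite coef1 -(subnKC s1) addnS /= => /esym/eqP.
by rewrite mulf_eq0 !lead_coef_eq0 (negPf R0) (negPf s0).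
Qed.

Lemma step_neq0 a : step a != 0 :> D.
Proof.
rewrite /step; case: (a =P 0) => _.
  apply: contraNneq (oner_neq0 k) => /(congr1 (fun P : D => wcoef P 0 1)).
  by rewrite wcoef0 /wcoef coefX coef1 => /eqP.
case: (a =P 1) => _.
  apply: contraNneq (oner_neq0 k) => /(congr1 (fun P : D => wcoef P 1 0)).
  by rewrite wcoef0 /wcoef coefC coefX => /eqP.
by apply: contraNneq (wcoef_Euler a) => ->; rewrite wcoef0.
Qed.

Lemma Mgen_neq0 a n : Mgen a n != 0 :> D.
Proof.
elim: n a => [|n IH] a; first by rewrite Mgen0 oner_neq0.
rewrite Mgen_rec; apply: contraNneq (IH (nxt a)) => e.
by rewrite (weyl_mul_eq0 e) ?step_neq0.
Qed.

(** Cancelling [Mgen a l] on the right would make a nonempty word, hence its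
    last letter, left invertible. *)
Lemma Mgen_strict a l n (R : D) : (l < n)%N -> Mgen a l <> R * Mgen a n.
Proof.
move=> ln; have [m ->] : exists m, n = (m.+1 + l)%N.
  by exists (n - l.+1)%N; rewrite addSnnS subnK.
rewrite Mgen_add => e.
have : (1 - R * Mgen (iter l (@nxt k) a) m.+1) * Mgen a l = 0.
  by rewrite mulrBl mul1r {1}e mulrA subrr.
move/weyl_mul_eq0/(_ (Mgen_neq0 a l))/eqP; rewrite subr_eq0 => /eqP.
by rewrite Mgen_rec mulrA; exact: step_not_invertible.
Qed.

End WeylDomain.

(** * The modules M(a, n) and the classification *)

Section CyclicIso.
Variable k : fieldType.
Variable M : grMod k.
Variables (i : int) (v : M) (w : weyl k) (hw : exists e, w \in homog e).
Hypothesis v_piece : v \in piece i.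
Hypothesis v_gen : forall x : M, exists Q : weyl k, x = Q *: v.
Hypothesis v_ann : forall Q : weyl k, Q *: v = 0 <-> exists R, Q = R * w.
Local Notation P := (grPrincipal hw).
Local Notation pi := (lpi (gr_submod P)).

Lemma pi_eq (Q R : weyl k) : pi Q = pi R <-> Q *: v = R *: v.
Proof.
have e : pi Q = pi R <-> Q - R \in gr_mem P.
  split=> [/eqP|h]; first by rewrite lpi_eq.
  by apply/eqP; rewrite lpi_eq.
rewrite e; split=> [/asboolP/v_ann/eqP|h].
  by rewrite scalerBl subr_eq0 => /eqP.
by apply/asboolP/v_ann; rewrite scalerBl h subrr.
Qed.

Definition to_quot (x : M) : grQuot P := pi (projT1 (cid (v_gen x))).
Definition of_quot (q : grQuot P) : M :=
  projT1 (cid (lpi_surj (q : lquot (gr_submod P)))) *: v.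

Lemma to_quotE Q : to_quot (Q *: v) = pi Q.
Proof. by rewrite /to_quot; case: cid => R /= e; apply/pi_eq. Qed.

Lemma of_quotE Q : of_quot (pi Q) = Q *: v.
Proof. by rewrite /of_quot; case: cid => R /= e; apply/esym/pi_eq. Qed.

Lemma to_quot_linear : linear to_quot.
Proof.
move=> a x y; have [Q ->] := v_gen x; have [R ->] := v_gen y.
by rewrite scalerA -scalerDl !to_quotE raddfD -linearZ.
Qed.

Lemma of_quot_linear : linear of_quot.
Proof.
move=> a x y; have [Q ->] := lpi_surj x; have [R ->] := lpi_surj y.
by rewrite -linearZ -raddfD !of_quotE scalerDl scalerA.
Qed.

Lemma cyclic_iso : grIso M (grQuot P).
Proof.
pose F : {linear M -> grQuot P} :=
  HB.pack to_quot (GRing.isLinear.Build _ _ _ _ _ to_quot_linear).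
pose G : {linear grQuot P -> M} :=
  HB.pack of_quot (GRing.isLinear.Build _ _ _ _ _ of_quot_linear).
exists F, G; split.
- exists (- i) => j x hx; have [Q eQ] := v_gen x; move: hx; rewrite eQ.
  case/(cyclic_homog v_piece) => R hR ->; rewrite /F /= to_quotE.
  by apply/asboolP; exists R.
- exists i => j x /asboolP[R hR ->]; rewrite /G /= of_quotE.
  exact: piece_act.
- by move=> x; have [Q ->] := v_gen x; rewrite /F /G /= to_quotE of_quotE.
- by move=> x; have [Q ->] := lpi_surj x; rewrite /F /G /= of_quotE to_quotE.
Qed.

End CyclicIso.

Section StandardModules.
Variable k : fieldType.
Hypothesis k_char0 : [pchar k] =i pred0.
Variables (I : set k) (I_res : residue_system I).
Implicit Types (M : grMod k) (a : k).

(** The modules isomorphic to [M(a, n)] up to a shift of the grading,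
    characterized by their elements. *)
Definition is_standard M a n : Prop := exists i (v : M),
  [/\ typed I a i v, (0 < n)%N, Mgen a n *: v = 0,
      forall l, (l < n)%N -> Mgen a l *: v != 0
    & forall x : M, exists Q : weyl k, x = Q *: v].

Lemma is_standard_iso M a n : is_standard M a n -> grIso M (grM a n).
Proof.
move=> [i [v [tv _ z nz gen]]]; have [_ hv _] := tv.
apply: (cyclic_iso _ hv gen) => Q; split=> [|[R ->]].
  exact: (annihilator k_char0 I_res tv nz z).
by rewrite -scalerA z scaler0.
Qed.

Lemma is_standard_uniserial M a n : is_standard M a n -> grUniserial M.
Proof.
move=> [i [v [tv _ z _ gen]]] A B; have hv := typed_piece tv.
have all (C : grSub M) : grsub_le C (grCyc hv).
  by move=> x _; apply/grCycP.
exact: (cyc_chain k_char0 I_res tv z (all A) (all B)).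
Qed.

(** Two summands are comparable, so the smaller one is contained in their zero
    intersection. *)
Lemma chain_indecomposable M : (exists x : M, x != 0) -> grUniserial M ->
  grIndecomposable M.
Proof.
move=> nz chain; split=> // A B dir.
have disj x : x \in A -> x \in B -> x = 0.
  move=> xA xB; have [f [_ uf]] := dir x.
  have f1 := uf [ffun b : bool => if b then x else 0].
  have f2 := uf [ffun b : bool => if b then 0 else x].
  have /ffunP/(_ true) : [ffun b : bool => if b then x else 0]
      = [ffun b : bool => if b then 0 else x].
    rewrite -f1 ?f2 //; (split; [by case; rewrite ffunE ?rpred0|]);
      by rewrite big_bool !ffunE /= ?addr0 ?add0r.
  by rewrite !ffunE.
have [AB|BA] := chain A B; [left|right] => x; rewrite inE; apply/idP/eqP.
- by move=> xA; apply: disj (AB _ xA).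
- by move=> ->; exact: rpred0.
- by move=> xB; apply: disj => //; exact: BA.
- by move=> ->; exact: rpred0.
Qed.

Lemma is_standard_indecomposable M a n :
  is_standard M a n -> grIndecomposable M.
Proof.
move=> h; apply: chain_indecomposable (is_standard_uniserial h).
have [i [v [_ n0 _ nz _]]] := h; exists v.
by have := nz 0%N n0; rewrite Mgen0 scale1r.
Qed.

Lemma is_standard_holonomic M a n : is_standard M a n -> grHolonomic M.
Proof.
move=> [i [v [tv _ z nz gen]]].
have hp m : exists j, Mgen a m *: v \in piece j.
  by have [j /typed_piece] := typed_Mgen I_res m tv.
exists n, (fun j => grCyc (hp (n - j)%N)); split.
- move=> x; rewrite inE subn0; apply/idP/eqP => [/grCycP[Q ->]|->].
    by rewrite z scaler0.
  exact: rpred0.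
- move=> x; rewrite inE subnn; have [Q ->] := gen x; apply/grCycP.
  by exists Q; rewrite Mgen0 scale1r.
move=> j jn.
have cover b l (y y' : M) (hy : exists j, y \in piece j)
    (hy' : exists j, y' \in piece j) :
    typed I b l y -> y != 0 -> y' = step b *: y ->
    grsub_cover (grCyc hy') (grCyc hy).
  move=> ty y0 e; move: hy'; rewrite e => hy'.
  exact: (cyc_cover k_char0 I_res hy hy' ty y0).
have [l tl] := typed_Mgen I_res (n - j.+1)%N tv.
apply: (cover _ _ _ _ _ _ tl).
  by apply: nz; rewrite ltn_subrL /= (leq_ltn_trans _ jn).
by rewrite scalerA -Mgen1 -Mgen_add add1n subnSK.
Qed.

(** The generator is the class of 1; its length is [n] by [Mgen_strict]. *)
Lemma grM_standard a n : I a -> (0 < n)%N -> is_standard (grM a n) a n.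
Proof.
move=> Ia n0; pose pi := lpi (gr_submod (grPrincipal (Mgen_homog a n))).
pose v : grM a n := pi 1.
have act (Q : weyl k) : Q *: v = pi Q.
  by rewrite /v -linearZ; congr (pi _); exact: mulr1.
have pi0 (Q : weyl k) : pi Q = 0 <-> exists R, Q = R * Mgen a n.
  by split=> [/eqP|h]; [rewrite lpi_eq0 => /asboolP|
     apply/eqP; rewrite lpi_eq0; exact/asboolP].
have z : Mgen a n *: v = 0 by rewrite act; apply/pi0; exists 1; rewrite mul1r.
have hv : v \in piece 0 by apply/asboolP; exists 1 => //; exact: homog1.
exists 0, v; split => //; first exact: (Mgen_typed I_res Ia hv z).
  move=> l ln; apply/eqP; rewrite act => /pi0[R]; exact: Mgen_strict.
by move=> x; have [Q ->] := lpi_surj x; exists Q; rewrite act.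
Qed.

Lemma sub_standard M (A : grSub M) a n : standard I A a n ->
  is_standard (grSubMod A) a n.
Proof.
move=> [i [v [hv [tv n0 z nz ->]]]].
pose u : grSubMod (grCyc hv) := Sub v (grCyc_gen hv).
have vu (Q : weyl k) : val (Q *: u) = Q *: v by rewrite linearZ.
have [Ia hp [m gm]] := tv.
exists i, u; split.
- by split=> //; exists m; apply: val_inj; rewrite vu gm.
- exact: n0.
- by apply: val_inj; rewrite vu z.
- by move=> l /nz; apply: contraNneq => e; rewrite -vu e.
- move=> x; have /grCycP[Q eQ] := valP x; exists Q.
  by apply: val_inj; rewrite vu.
Qed.

End StandardModules.

Lemma kmodZ_eq (k : fieldType) (x y : k) :
  to_kmodZ x = to_kmodZ y <-> exists m : int, x - y = m%:~R.
Proof.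
split=> [e|[m e]].
  have : x - y \in @kint k by rewrite Quotient.idealrBE; apply/eqP.
  by move/asboolP.
by apply/eqP; rewrite -Quotient.idealrBE; apply/asboolP; exists m.
Qed.

(** The class of [0] is represented twice in the index set, by [0] for the
    eigenvalues [0, 1, ...] and by [1] for the eigenvalues [-1, -2, ...]. *)
Lemma transversal_residue_system (k : fieldType) (I' : set k) :
    I' 0 -> set_bij I' setT (@to_kmodZ k) ->
  residue_system (I' `|` [set 1])%classic.
Proof.
move=> I'0 [_ inj surj].
have I'eq x y : I' x -> I' y -> (exists m : int, x - y = m%:~R) -> x = y.
  by move=> hx hy /kmodZ_eq; apply: inj; rewrite in_setE.
have one_int : 1 \in @kint k by apply/asboolP; exists 1.
split; first by left.
- by right.
- move=> a [Ia|->]; last by constructor 2.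
  have [/asboolP[m am]|na] := boolP (a \in @kint k); last by constructor 3.
  by constructor 1; apply: (I'eq a 0) => //; exists m; rewrite subr0.
- move=> a b [Ia|->]; last by rewrite one_int.
  move=> [Ib|->] na; first by move/asboolP; exact: I'eq.
  by move=> h; case/negP: na; rewrite -[a](subrK 1) rpredD.
move=> c; have [a Ia] := surj (to_kmodZ c) Logic.I.
move/esym/kmodZ_eq => -[m em].
have ec : c = a + m%:~R by rewrite -em addrCA subrr addr0.
have [/asboolP[l al]|na] := boolP (a \in @kint k).
  have a0 : a = 0 by apply: (I'eq a 0) => //; exists l; rewrite subr0.
  case: m em ec => p _ ec.
    exists 0, p; split; first by left.
    by left; rewrite eq_sym oner_eq0 /ev eq_sym oner_eq0 ec a0.
  exists 1, p; split; first by right.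
  right; rewrite oner_neq0 /ev eqxx ec a0 add0r NegzE rmorphN /=.
  by rewrite -opprD nat1r.
have a0 : a != 0 by apply: contraNneq na => ->; apply/asboolP; exists 0.
have a1 : a != 1 by apply: contraNneq na => ->.
case: m em ec => p _ ec.
  exists a, p; split; first by left.
  by left; rewrite /ev (negPf a1).
exists a, p.+1; split; first by left.
by right; rewrite /ev (negPf a1) ec NegzE rmorphN.
Qed.

Section FiniteLengthModules.
Variable k : closedFieldType.
Hypothesis k_char0 : [pchar k] =i pred0.
Variables (I : set k) (I_res : residue_system I).
Implicit Types M : grMod k.

(** The complement produced by [cyclic_summand] must vanish. *)
Lemma indecomposable_standard M : grHolonomic M -> grIndecomposable M ->
  exists a n, [/\ I a, (1 <= n)%N & is_standard I M a n].
Proof.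
move=> [len [N [N0 Nlen Ncover]]] [[x xn] indec].
have [|a [i [v [n [hv [K [[tv _] z nz [_ KL] hM]]]]]]] :=
  cyclic_summand k_char0 I_res N0 Nlen Ncover (B := grFull M).
  by exists x.
have dir : grDirectSum (fun b : bool => if b then grCyc hv else K).
  move=> y; have /grAddP[l [u [lL uK ey]]] := hM y isT.
  exists [ffun b : bool => if b then l else u]; split.
    split; first by case; rewrite ffunE.
    by rewrite big_bool !ffunE.
  move=> f [hf]; rewrite big_bool /= => ef.
  have fL := hf true; have fK := hf false; rewrite /= in fL fK.
  have e : u - f false = f true - l.
    by apply/eqP; rewrite subr_eq addrAC eq_sym subr_eq -ef ey addrC.
  have d0 : u - f false = 0 by apply: KL; [|rewrite e]; apply: rpredB.
  apply/ffunP => -[]; rewrite ffunE; apply/eqP; rewrite eq_sym -subr_eq0.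
    by rewrite -e d0.
  by rewrite -opprB d0 oppr0.
have [L0|K0] := indec _ _ dir.
  have := grCyc_gen hv; rewrite L0 inE => /eqP v0.
  by rewrite v0 scaler0 eqxx in nz.
have [Ia _ _] := tv; exists a, n.+1; split => //; exists i, v; split => //.
  move=> l; rewrite ltnS => ln.
  by apply: contraNneq nz => zl; rewrite (Mgen_mono ln zl).
move=> y; have /grAddP[l [u [/grCycP[Q ->] uK ->]]] := hM y isT.
by move: uK; rewrite K0 inE => /eqP ->; exists Q; rewrite addr0.
Qed.

Lemma holonomic_decomposition M : grHolonomic M ->
  exists (r : nat) (N : 'I_r -> grSub M) (a : 'I_r -> k) (n : 'I_r -> nat),
    grDirectSum N /\
    forall j, [/\ I (a j), (1 <= n j)%N
                 & is_standard I (grSubMod (N j)) (a j) (n j)].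
Proof.
move=> [len [N [N0 Nlen Ncover]]].
have [r [S [a [n [std _ gen ind]]]]] :=
  decomposition k_char0 I_res N0 Nlen Ncover (grFull M).
exists r, (fun j => S j), (fun j => a j), (fun j => n j); split.
  move=> x; have [f hf ex] := gen x isT; exists [ffun j : 'I_r => f j]; split.
    split; first by move=> j; rewrite ffunE hf.
    by rewrite ex; apply: eq_bigr => j _; rewrite ffunE.
  move=> f' [hf' ex']; apply/ffunP => j; rewrite ffunE; apply/eqP.
  pose g l := if insub l is Some j then f l - f' j else 0.
  have gE (l : 'I_r) : g l = f l - f' l by rewrite /g valK.
  rewrite -subr_eq0 -gE; apply/eqP; apply: (ind g) => //.
    by move=> l lr; rewrite (gE (Ordinal lr)) rpredB ?hf.
  under eq_bigr do rewrite gE.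
  by rewrite sumrB -ex -ex' subrr.
move=> j; have sj := std j (ltn_ord j).
have [i [v [hv [[Ia _ _] nj _ _ _]]]] := sj; split => //.
exact: sub_standard.
Qed.

End FiniteLengthModules.

Theorem theorem28 (k : closedFieldType) (k_char0 : [pchar k]%R =i pred0)
    (I' : set k) (I'0 : I' 0%R) (I'bij : set_bij I' setT (@to_kmodZ k)) :
  let I := (I' `|` [set 1%R])%classic in
  [/\ grHol_uniserial k,
      (forall (alpha : k) (n : nat), I alpha -> (1 <= n)%N ->
         grHolonomic (grM alpha n) /\ grIndecomposable (grM alpha n)),
      (forall M : grMod k, grHolonomic M -> grIndecomposable M ->
         exists (alpha : k) (n : nat),
           [/\ I alpha, (1 <= n)%N & grIso M (grM alpha n)]) &
      (forall M : grMod k, grHolonomic M ->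
         exists (r : nat) (N : 'I_r -> grSub M) (alpha : 'I_r -> k)
                (n : 'I_r -> nat),
           grDirectSum N /\
           forall j : 'I_r, [/\ I (alpha j), (1 <= n j)%N &
                                grIso (grSubMod (N j)) (grM (alpha j) (n j))])].
Proof.
move=> I; have I_res : residue_system I := transversal_residue_system I'0 I'bij.
split.
- move=> M hM iM.
  have [a [n [_ _ std]]] := indecomposable_standard k_char0 I_res hM iM.
  exact: (is_standard_uniserial k_char0 I_res std).
- move=> a n Ia n1; have std := grM_standard I_res Ia n1; split.
    exact: (is_standard_holonomic k_char0 I_res std).
  exact: (is_standard_indecomposable k_char0 I_res std).
- move=> M hM iM.
  have [a [n [Ia n1 std]]] := indecomposable_standard k_char0 I_res hM iM.
  by exists a, n; split=> //; exact: (is_standard_iso k_char0 I_res std).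
move=> M hM.
have [r [N [a [n [dir h]]]]] := holonomic_decomposition k_char0 I_res hM.
exists r, N, a, n; split=> // j; have [Ia n1 std] := h j; split=> //.
exact: (is_standard_iso k_char0 I_res std).
Qed.
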